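(* Let $\beta\in(1,\infty)$ be a real number such that the Perron-Frobenius operator $\mathcal{L}_\beta$ has a non-leading eigenvalue. Assume that all the sub-leading eigenvalues $\lambda_1,\dots,\lambda_N$ of $\mathcal{L}_\beta$ (listed without repetition) are simple. Let $K\ge1$ be an integer, let $c_i\in\mathbb{C}$ and $x_i\in[0,1]$ for $0\le i\le N+K$ with $x_j\ne x_k$ if $j\ne k$, and let $f:[0,1]\to\mathbb{C}$ be the step function $$f(x)=\sum_{i=0}^{N+K}c_i\mathbf{1}_{[0,x_i]}(x).$$ Then $f$ has a good decay rate of correlations if the coefficients $\{c_i\}_{i=0}^{N+K}$ are a solution of the following $(N+1)\times(N+K+1)$ matrix equation: $$\begin{pmatrix} x_0 & \cdots & x_{N+K} \\ F_{\lambda_1}(x_0) & \cdots & F_{\lambda_1}(x_{N+K}) \\ \vdots & \ddots & \vdots \\ F_{\lambda_N}(x_0) & \cdots & F_{\lambda_N}(x_{N+K}) \end{pmatrix} \begin{pmatrix} c_0 \\ c_1 \\ \vdots \\ c_{N+K} \end{pmatrix}=0,$$ where $F_{\lambda_i}(x)=\sum_{n=1}^\infty\frac{a_n(\beta,x)}{\beta^n\lambda_i^n}$ for $x\in[0,1]$ and $1\le i\le N$.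
   Context: For real $\beta>1$, the beta-map is $\tau_\beta:[0,1]\to[0,1]$, $\tau_\beta(x)=\beta x-[\beta x]$, where $[y]$ is the integer part of $y\ge 0$; $\tau_\beta^0(x)=x$. For $x\in[0,1]$ and $n\ge1$ put $a_n(\beta,x)=[\beta\tau_\beta^{n-1}(x)]$. $\mathbf{1}_A$ is the indicator function of $A$. Let $BV$ be the Banach space of functions $f:[0,1]\to\mathbb{C}$ of bounded variation with norm $\|f\|_{BV}=\operatorname{var}(f)+\sup_{x\in[0,1]}|f(x)|$, let $\mathcal{N}\subset BV$ be the closed subspace of those $f\in BV$ that vanish outside some countable set, and let $\widehat{BV}=BV/\mathcal{N}$ with the quotient norm $\|f\|_{\widehat{BV}}=\inf_{g\in\mathcal{N}}\|f+g\|_{BV}$. The Perron-Frobenius operator $\mathcal{L}_\beta f(x)=\frac1\beta\sum_{y\in[0,1],\,\tau_\beta(y)=x}f(y)$ is considered as a bounded operator on $\widehat{BV}$. Every spectral value $\lambda$ of $\mathcal{L}_\beta$ with $|\lambda|>1/\beta$ is an isolated eigenvalue of finite multiplicity and satisfies $|\lambda|\le 1$. The number $1$ is the leading eigenvalue; a non-leading eigenvalue is an eigenvalue $\lambda\neq1$ with $|\lambda|>1/\beta$ (it then satisfies $1/\beta<|\lambda|<1$). An eigenvalue is simple if its algebraic multiplicity, i.e. the dimension of $\{f\in\widehat{BV}:\exists n\ge1,\ (\lambda I-\mathcal{L}_\beta)^nf=0\}$, is $1$. If $\mathcal{L}_\beta$ has a non-leading eigenvalue, put $M(\beta)=\max\{|\lambda|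 : \lambda\text{ is a non-leading eigenvalue of }\mathcal{L}_\beta\}$, so $1/\beta<M(\beta)<1$. A non-leading eigenvalue $\lambda$ is sub-leading if $|\lambda|=M(\beta)$ (there are finitely many). A function $f\in\widehat{BV}$ has a good decay rate of correlations if there are a constant $C>0$ and a number $\alpha$ with $1/\beta\le\alpha<M(\beta)$ such that $\|\mathcal{L}_\beta^nf\|_{\widehat{BV}}\le C\alpha^n$ for all $n\ge1$. *)

(* Defs.v *)
From HB Require Import structures.
From mathcomp Require Import all_boot all_order all_algebra generic_quotient ring_quotient.
From mathcomp Require Import complex.
From mathcomp Require Import all_classical all_reals all_analysis.

Set Implicit Arguments.
Unset Strict Implicit.
Unset Printing Implicit Defensive.

Import Order.TTheory GRing.Theory Num.Theory.
Import numFieldNormedType.Exports.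
Import ComplexField.Normc.

Local Open Scope classical_set_scope.
Local Open Scope ring_scope.
Local Open Scope complex_scope.
Local Open Scope quotient_scope.

(* Throughout, [0,1] is the type {i01 R}, and complex-valued functions land in
   R[i]^o, which is R[i] seen as a left module over itself (and carrying the
   topology of its modulus); normc : R[i] -> R is the real-valued modulus. *)

Section BoundedVariation.
Variable R : realType.
Implicit Types (f g : {i01 R} -> R[i]^o) (s : seq {i01 R}) (x y : {i01 R}).

Definition variation_along f s : R :=
  \sum_(p <- zip s (behead s)) normc (f p.2 - f p.1).

Definition variation_values f : set R :=
  [set variation_along f s | s in [set s | sorted <=%O s]].

Definition var f : R := sup (variation_values f).

Definition bv f : Prop := has_ubound (variation_values f).

Definition bv_pred : {pred {i01 R} -> R[i]^o} := [pred f | `[< bv f >]].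

Lemma variation_cons2 f x y s :
  variation_along f (x :: y :: s) = normc (f y - f x) + variation_along f (y :: s).
Proof. by rewrite /variation_along /= big_cons. Qed.

Lemma variation_rcons2 f s x y :
  variation_along f (rcons (rcons s x) y) =
  variation_along f (rcons s x) + normc (f y - f x).
Proof.
elim: s => [|a [|b s] IH] /=.
- by rewrite /variation_along /= big_cons !big_nil addrC.
- by move: IH; rewrite /= !variation_cons2 => ->; rewrite addrA.
- by move: IH; rewrite /= !(variation_cons2 _ a b) => ->; rewrite addrA.
Qed.

Lemma variation1 f x : variation_along f [:: x] = 0.
Proof. by rewrite /variation_along big_nil. Qed.

Lemma normc_ge0 (z : R[i]) : 0 <= normc z.
Proof. by case: z => a b; exact: sqrtr_ge0. Qed.

Definition clip01 (r : R) : R := Num.max 0 (Num.min r 1).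

Lemma clip01_ge0 r : 0 <= clip01 r.
Proof. by rewrite le_max lexx. Qed.

Lemma clip01_le1 r : clip01 r <= 1.
Proof. by rewrite ge_max ler01 ge_min lexx orbT. Qed.

Definition to01 (r : R) : {i01 R} := Itv01 (clip01_ge0 r) (clip01_le1 r).

Lemma to01K (r : R) : 0 <= r <= 1 -> (to01 r)%:num = r.
Proof.
by move=> /andP[r0 r1]; rewrite /= /clip01 (min_idPl r1) (max_idPr r0).
Qed.

Lemma num01_ge0 x : 0 <= x%:num.
Proof. by []. Qed.

Lemma num01_le1 x : x%:num <= 1.
Proof. by []. Qed.

Lemma le01 x : (to01 0 <= x)%O.
Proof. by rewrite -num_le to01K ?lexx ?ler01 ?num01_ge0. Qed.

Lemma lex1 x : (x <= to01 1)%O.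
Proof. by rewrite -num_le to01K ?lexx ?ler01 ?num01_le1. Qed.

Lemma bvP f : bv f <-> exists V : {i01 R} -> R,
  forall x y, (x <= y)%O -> normc (f y - f x) <= V y - V x.
Proof.
split=> [[M fM]|[V fV]].
- pose S x := [set variation_along f (rcons s x) |
                s in [set s | sorted <=%O (rcons s x)]].
  have S0 x : S x !=set0 by exists (variation_along f (rcons [::] x)); exists [::].
  have Sub x : has_ubound (S x).
    by exists M => _ [s ss <-]; apply: fM; exists (rcons s x).
  exists (fun x => sup (S x)) => x y xy.
  rewrite lerBrDr addrC -lerBrDr; apply: ge_sup => // _ [s ss <-].
  rewrite lerBrDr -variation_rcons2; apply: ub_le_sup => //.
  exists (rcons s x) => //=; move: ss => /=.
  case: s => [|a s] /=; first by rewrite xy.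
  by rewrite (rcons_path _ _ (rcons s x) y) last_rcons => ->.
- have Vle x y : (x <= y)%O -> V x <= V y.
    by move=> xy; rewrite -subr_ge0 (le_trans _ (fV _ _ xy))// normc_ge0.
  exists (V (to01 1) - V (to01 0)) => _ [[|x s] /= ss <-].
    by rewrite /variation_along big_nil subr_ge0 Vle ?le01.
  apply: (@le_trans _ _ (V (last x s) - V x)); last first.
    by rewrite lerB ?Vle ?le01 ?lex1.
  elim: s x ss => [x _|y s IH x /= /andP[xy ys]].
    by rewrite variation1 subrr.
  rewrite variation_cons2.
  apply: (le_trans (lerD (fV _ _ xy) (IH _ ys))).
  by rewrite addrC addrA subrK.
Qed.

Lemma bv_bounded f : bv f -> exists2 B : R, 0 <= B & forall x, normc (f x) <= B.
Proof.
move=> [M fM]; exists (M + normc (f (to01 0))) => [|x].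
  rewrite addr_ge0 ?normc_ge0//; apply: fM; exists [::] => //.
  by rewrite /variation_along big_nil.
rewrite -[f x](subrK (f (to01 0))); apply: (le_trans (le_normcD _ _)).
rewrite lerD2r; apply: fM; exists [:: to01 0; x] => /=.
  by rewrite andbT le01.
by rewrite variation_cons2 variation1 addr0.
Qed.

Lemma bv_cst0 : bv (fun=> 0).
Proof. by apply/bvP; exists (fun=> 0) => x y _; rewrite !subrr normc0. Qed.

Lemma bvD f g : bv f -> bv g -> bv (f + g).
Proof.
move=> /bvP[V fV] /bvP[W gW]; apply/bvP; exists (fun x => V x + W x) => x y xy.
have -> : (f + g) y - (f + g) x = (f y - f x) + (g y - g x).
  by rewrite /= opprD addrACA.
apply: (le_trans (le_normcD _ _)); apply: (le_trans (lerD (fV _ _ xy) (gW _ _ xy))).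
by rewrite opprD addrACA.
Qed.

Lemma bvZ (a : R[i]) f : bv f -> bv (a *: f).
Proof.
move=> /bvP[V fV]; apply/bvP; exists (fun x => normc a * V x) => x y xy.
by rewrite -mulrBr -scalerBr normcM ler_wpM2l ?normc_ge0 ?fV.
Qed.

Lemma bv_sum (I : Type) (r : seq I) (F : I -> {i01 R} -> R[i]^o) :
  (forall i, bv (F i)) -> bv (\sum_(i <- r) F i).
Proof.
by move=> bF; elim/big_ind: _ => //; [exact: bv_cst0 | exact: bvD].
Qed.

Lemma bv_submod_closed : submod_closed bv_pred.
Proof.
split=> [|a f g]; rewrite !unfold_in /=; first by apply/asboolP; exact: bv_cst0.
by move=> /asboolP bf /asboolP bg; apply/asboolP/bvD => //; exact: bvZ.
Qed.

HB.instance Definition _ := GRing.isSubmodClosed.Build _ _ bv_pred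
  bv_submod_closed.

(* f cut off to 0 outside an initial segment J, after a nondecreasing change
   of variable on J *)
Lemma bv_initial f (J : pred {i01 R}) (phi : {i01 R} -> {i01 R}) : bv f ->
  (forall x y, (x <= y)%O -> J y -> J x) ->
  (forall x y, (x <= y)%O -> J y -> (phi x <= phi y)%O) ->
  bv (fun x => if J x then f (phi x) else 0).
Proof.
move=> bf J_init phi_homo.
have [B B0 fB] := bv_bounded bf; have /bvP[V fV] := bf.
have Vle x y : (x <= y)%O -> V x <= V y.
  by move=> xy; rewrite -subr_ge0 (le_trans _ (fV _ _ xy))// normc_ge0.
have Vle1 x : V x <= V (to01 1).
  exact/Vle/lex1.
apply/bvP; exists (fun x => if J x then V (phi x) else V (to01 1) + B) => x y xy.
case: ifPn => Jy.
  by rewrite (J_init _ _ xy Jy); apply: fV; exact: phi_homo.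
case: ifPn => Jx; last by rewrite !subrr normc0.
rewrite sub0r normcN (le_trans (fB _))// -addrAC lerDr subr_ge0.
exact: Vle1.
Qed.

End BoundedVariation.

Section BVSpace.
Variable R : realType.

Record BV := mkBV {
  BV_fun :> {i01 R} -> R[i]^o;
  BV_bv : BV_fun \in @bv_pred R }.

HB.instance Definition _ := [isSub for BV_fun].
HB.instance Definition _ := [Choice of BV by <:].
HB.instance Definition _ := [SubChoice_isSubLmodule of BV by <:].

(* both suprema are finite on BV *)
Definition BV_norm (f : BV) : R := var f + sup [set normc (f x) | x in setT].

Definition vanishes_off_countable (f : BV) : Prop :=
  exists2 A : set {i01 R}, countable A & forall x, ~ A x -> f x = 0.

(* the closed subspace N of BV *)
Definition nullBV : {pred BV} := [pred f | `[< vanishes_off_countable f >]].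

Lemma nullBV_submod_closed : submod_closed nullBV.
Proof.
split=> [|a f g]; rewrite !unfold_in /=; first by apply/asboolP; exists set0.
move=> /asboolP[A cA fA] /asboolP[B cB gB]; apply/asboolP.
exists (A `|` B); first by rewrite -bigcup2E; apply: bigcup_countable => // -[|[]] //= *.
move=> x /not_orP[Ax Bx].
by rewrite -[LHS]/(a *: f x + g x) fA// gB// scaler0 addr0.
Qed.

HB.instance Definition _ := GRing.isSubmodClosed.Build _ _ nullBV
  nullBV_submod_closed.

End BVSpace.

Section BetaMap.
Variables (R : realType) (beta : R).
Implicit Types (x y : {i01 R}) (f g : {i01 R} -> R[i]^o).

Lemma tau_ge0 x : 0 <= beta * x%:num - (Num.floor (beta * x%:num))%:~R.
Proof. by rewrite subr_ge0 ge_floor. Qed.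

Lemma tau_le1 x : beta * x%:num - (Num.floor (beta * x%:num))%:~R <= 1.
Proof. by rewrite lerBlDl ltW// -intrD1 floorD1_gt. Qed.

(* beta * x is nonnegative, so its integer part is its floor *)
Definition tau x : {i01 R} := Itv01 (tau_ge0 x) (tau_le1 x).

Definition digit (n : nat) x : int :=
  Num.floor (beta * (iter n.-1 tau x)%:num).

(* the fibres of tau are finite when 1 < beta (PF_branches), so \sum_( \in )
   does not default to 0 *)
Definition PF f : {i01 R} -> R[i]^o :=
  fun x => (beta^-1)%:C *: \sum_(y \in [set y | tau y = x]) f y.

Hypothesis beta_gt1 : 1 < beta.

Let beta_gt0 : 0 < beta. Proof. exact: lt_trans beta_gt1. Qed.

Let inbranch (k : nat) x := (x%:num < 1) && (x%:num + k%:R <= beta).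
Let branch (k : nat) x := to01 ((x%:num + k%:R) / beta).

Let branchE k x : inbranch k x -> (branch k x)%:num = (x%:num + k%:R) / beta.
Proof.
move=> /andP[x1 xk]; rewrite to01K// ler_pdivrMr// mul1r xk andbT.
by rewrite divr_ge0 ?addr_ge0// ltW.
Qed.

Lemma PF_branches f : PF f =
  (beta^-1)%:C *: \sum_(k < (Num.truncn beta).+1)
     (fun x => if inbranch k x then f (branch k x) else 0).
Proof.
apply/funext => x; rewrite /PF /=; congr (_ *: _).
rewrite fct_sumE (@fsbig_ord _ _ _ _ (fun k => if inbranch k x then f (branch k x) else 0)).
pose Q := [set k : nat | inbranch k x].
have -> : [set y | tau y = x] = (fun k => branch k x) @` (`I_(Num.truncn beta).+1 `&` Q).
  apply/seteqP; split=> [y /= yx|_ [k [_ /= kx] <-]].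
  - have y0 : 0 <= beta * y%:num by rewrite mulr_ge0 ?(ltW beta_gt0).
    have xE : x%:num = beta * y%:num - (Num.floor (beta * y%:num))%:~R.
      by rewrite -yx.
    have x1 : x%:num < 1 by rewrite xE ltrBlDl -intrD1 floorD1_gt.
    have kE : (Num.floor (beta * y%:num))%:~R = (Num.truncn (beta * y%:num))%:R :> R.
      by rewrite truncn_floor y0 -[in LHS](@gez0_abs (Num.floor _)) ?floor_ge0.
    have xk : x%:num + (Num.truncn (beta * y%:num))%:R = beta * y%:num.
      by rewrite -kE xE subrK.
    have yb : beta * y%:num <= beta by rewrite ler_piMr ?num01_le1 ?(ltW beta_gt0).
    have kx : inbranch (Num.truncn (beta * y%:num)) x by rewrite /inbranch x1 xk.
    exists (Num.truncn (beta * y%:num)).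
      by split => //=; rewrite ltnS le_truncn.
    apply/val_inj; rewrite [LHS]branchE// xk mulrAC divff ?mul1r//.
    by rewrite gt_eqF.
  - apply/val_inj.
    rewrite -[LHS]/(beta * (branch k x)%:num -
                    (Num.floor (beta * (branch k x)%:num))%:~R).
    rewrite branchE// mulrCA divff ?gt_eqF// mulr1.
    have /andP[x1 _] := kx.
    rewrite (@floor_def _ _ k%:Z) ?addrK//.
    by rewrite lerDr num01_ge0 intrD addrC ltrD2l.
rewrite fsbig_image; last first.
  move=> k l /set_mem[_ kx] /set_mem[_ lx] /(congr1 (fun z => z%:num)).
  rewrite !branchE// => /(mulIf _)/addrI; rewrite invr_eq0 gt_eqF// => /(_ isT).
  by move=> /eqP; rewrite eqr_nat => /eqP.
rewrite fsbig_mkcondr; apply: eq_fsbigr => k _.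
case: ifPn => kQ; first by rewrite (set_mem kQ : inbranch k x).
by case: ifPn => // kx; rewrite mem_set in kQ.
Qed.

Lemma PF_bv f : bv f -> bv (PF f).
Proof.
move=> bf; rewrite PF_branches; apply: bvZ; apply: bv_sum => k.
apply: bv_initial => // x y; rewrite -num_le /= => xy /andP[y1 yk].
  by rewrite /inbranch (le_lt_trans xy y1) (le_trans _ yk)// lerD2r.
have kx : inbranch k x.
  by rewrite /inbranch (le_lt_trans xy y1) (le_trans _ yk)// lerD2r.
have ky : inbranch k y by rewrite /inbranch y1.
by rewrite -num_le !branchE// ler_pM2r ?invr_gt0// lerD2r.
Qed.

Lemma PF_scaleD (a : R[i]) f g : PF (a *: f + g) = a *: PF f + PF g.
Proof.
have CA (c : R[i]) (h : {i01 R} -> R[i]^o) : a *: (c *: h) = c *: (a *: h).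
  by rewrite !scalerA mulrC.
rewrite !PF_branches CA -scalerDr; congr (_ *: _); apply/funext => x.
rewrite -[RHS]/(a *: (\sum_(k < (Num.truncn beta).+1)
    (fun x => if inbranch k x then f (branch k x) else 0)) x +
  (\sum_(k < (Num.truncn beta).+1)
    (fun x => if inbranch k x then g (branch k x) else 0)) x).
rewrite !fct_sumE scaler_sumr -big_split/=; apply: eq_bigr => k _.
by case: ifP => // _; rewrite scaler0 addr0.
Qed.

Lemma PF_vanish f (A : set {i01 R}) : (forall y, ~ A y -> f y = 0) ->
  forall x, ~ (tau @` A) x -> PF f x = 0.
Proof.
move=> fA x Ax; rewrite /PF fsbig1 ?scaler0// => y /= yx.
by apply: fA => Ay; apply: Ax; exists y.
Qed.

End BetaMap.

Section BVhat.
Variable R : realType.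

Definition BVhat : Type := Quotient.quot (@nullBV R).

HB.instance Definition _ := GRing.Zmodule.on BVhat.

Definition BVclass (f : BV R) : BVhat := \pi_(Quotient.quot (@nullBV R)) f.
Definition BVrep (F : BVhat) : BV R := repr (F : Quotient.quot (@nullBV R)).

Lemma repK F : BVclass (BVrep F) = F.
Proof. exact: reprK. Qed.

Lemma class_eq f g : (BVclass f = BVclass g) <-> f - g \in @nullBV R.
Proof. by rewrite Quotient.idealrBE; split => [/eqP|/eqP]. Qed.

Lemma class_rep f : BVrep (BVclass f) - f \in @nullBV R.
Proof. by apply/class_eq; rewrite repK. Qed.

Lemma classD f g : BVclass (f + g) = BVclass f + BVclass g.
Proof. exact: raddfD. Qed.

Definition scaleBVhat (a : R[i]) (F : BVhat) : BVhat := BVclass (a *: BVrep F).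

Lemma class_scale a f : BVclass (a *: f) = scaleBVhat a (BVclass f).
Proof.
apply/class_eq; rewrite -scalerBr; apply: rpredZ.
by rewrite -opprB rpredN class_rep.
Qed.

Fact scaleBVhatA a b F : scaleBVhat a (scaleBVhat b F) = scaleBVhat (a * b) F.
Proof. by rewrite -(repK F) -!class_scale scalerA. Qed.

Fact scale1BVhat : left_id 1 scaleBVhat.
Proof. by move=> F; rewrite -(repK F) -class_scale scale1r. Qed.

Fact scaleBVhatDr : right_distributive scaleBVhat +%R.
Proof.
move=> a F G.
by rewrite -(repK F) -(repK G) -classD -!class_scale scalerDr classD.
Qed.

Fact scaleBVhatDl F : {morph scaleBVhat^~ F : a b / a + b}.
Proof.
by move=> a b; rewrite -(repK F) -!class_scale scalerDl classD.
Qed.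

HB.instance Definition _ := GRing.Zmodule_isLmodule.Build R[i] BVhat
  scaleBVhatA scale1BVhat scaleBVhatDr scaleBVhatDl.

Lemma classZ a f : BVclass (a *: f) = a *: BVclass f.
Proof. exact: class_scale. Qed.

Lemma class_eq0 f : (BVclass f = 0) <-> f \in @nullBV R.
Proof.
have -> : 0 = BVclass 0 by apply/esym; exact: raddf0.
by rewrite class_eq subr0.
Qed.

Definition BVhat_norm (F : BVhat) : R :=
  inf [set BV_norm (BVrep F + g) | g in [set g | g \in @nullBV R]].

End BVhat.

Section PFhat.
Variables (R : realType) (beta : R) (beta_gt1 : 1 < beta).

Lemma PF_BV_subproof (f : BV R) : PF beta f \in @bv_pred R.
Proof.
rewrite unfold_in; apply/asboolP/PF_bv => //.
by have := BV_bv f; rewrite unfold_in => /asboolP.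
Qed.

Definition PF_BV (f : BV R) : BV R := mkBV (PF_BV_subproof f).

Definition PFhat (F : BVhat R) : BVhat R := BVclass (PF_BV (BVrep F)).

Lemma PF_BV_linear (a : R[i]) f g : PF_BV (a *: f + g) = a *: PF_BV f + PF_BV g.
Proof. by apply/val_inj; exact: (PF_scaleD beta_gt1). Qed.

Lemma PF_BV_null f : f \in @nullBV R -> PF_BV f \in @nullBV R.
Proof.
rewrite !unfold_in => /asboolP[A cA fA]; apply/asboolP.
exists (tau beta @` A); first exact: sub_countable (card_image_le _ _) cA.
exact: PF_vanish.
Qed.

Lemma PFhat_class f : PFhat (BVclass f) = BVclass (PF_BV f).
Proof.
apply/class_eq; have /PF_BV_null := class_rep f.
by rewrite addrC -scaleN1r PF_BV_linear scaleN1r addrC.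
Qed.

Lemma PFhat_linear : linear PFhat.
Proof.
move=> a F G; rewrite -(repK F) -(repK G) -classZ -classD !PFhat_class.
by rewrite PF_BV_linear classD classZ.
Qed.

HB.instance Definition _ :=
  GRing.isLinear.Build R[i] (BVhat R) (BVhat R) _ PFhat PFhat_linear.

End PFhat.

Section StepFunctions.
Variable R : realType.

Definition step n (c : 'I_n -> R[i]) (x : 'I_n -> {i01 R}) :
    {i01 R} -> R[i]^o :=
  fun t => \sum_(i < n)
    c i * \1_[set u : {i01 R} | 0 <= u%:num <= (x i)%:num] t.

Lemma bv_indic (a : {i01 R}) :
  bv (\1_[set u : {i01 R} | 0 <= u%:num <= a%:num] : {i01 R} -> R[i]^o).
Proof.
apply/bvP; exists (fun u => (~~ (u <= a)%O)%:R) => u v uv.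
have memE w : (w \in [set u : {i01 R} | 0 <= u%:num <= a%:num]) = (w <= a)%O.
  rewrite -num_le; apply/idP/idP => [/set_mem/= /andP[]//|wa].
  by apply: mem_set => /=; rewrite wa num01_ge0.
rewrite !indicE !memE; have [va|va] := boolP (v <= a)%O.
  by rewrite (le_trans uv va) !subrr normc0.
case: (u <= a)%O; rewrite ?subrr ?normc0//.
by rewrite -[leLHS]/(normc (0 - 1 : R[i])) sub0r normcN normc1 subr0.
Qed.

Lemma step_subproof n (c : 'I_n -> R[i]) (x : 'I_n -> {i01 R}) :
  step c x \in @bv_pred R.
Proof.
rewrite unfold_in; apply/asboolP.
have -> : step c x = \sum_(i < n) c i *:
    (\1_[set u : {i01 R} | 0 <= u%:num <= (x i)%:num] : {i01 R} -> R[i]^o).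
  by apply/funext => t; rewrite fct_sumE.
by apply: bv_sum => i; apply: bvZ; exact: bv_indic.
Qed.

Definition step_BV n (c : 'I_n -> R[i]) (x : 'I_n -> {i01 R}) : BV R :=
  mkBV (step_subproof c x).

End StepFunctions.

Definition has_dim (K : pzRingType) (V : lmodType K) (S : set V) (d : nat) :=
  exists e : 'I_d -> V,
    (forall a : 'I_d -> K, \sum_i a i *: e i = 0 -> forall i, a i = 0) /\
    S = [set \sum_i a i *: e i | a in [set: 'I_d -> K]].

Section Spectrum.
Variables (R : realType) (beta : R) (beta_gt1 : 1 < beta).
Implicit Types (lam : R[i]) (F : BVhat R).
Let L := PFhat beta_gt1.

Definition PF_eigenvalue lam : Prop := exists2 F, F != 0 & L F = lam *: F.

Definition nonleading lam : Prop :=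
  [/\ PF_eigenvalue lam, lam != 1 & beta^-1 < normc lam].

Definition gen_eigenspace lam : set (BVhat R) :=
  [set F | exists2 n, (1 <= n)%N & iter n (fun G => lam *: G - L G) F = 0].

Definition simple_eigenvalue lam : Prop := has_dim (gen_eigenspace lam) 1.

(* a maximum whenever there is a non-leading eigenvalue *)
Definition subleading_modulus : R :=
  sup [set normc lam | lam in [set lam | nonleading lam]].

Definition subleading lam : Prop :=
  nonleading lam /\ normc lam = subleading_modulus.

Definition good_decay F : Prop :=
  exists C alpha : R, [/\ 0 < C, beta^-1 <= alpha < subleading_modulus &
    forall n, (1 <= n)%N -> BVhat_norm (iter n L F) <= C * alpha ^+ n].

End Spectrum.

Definition F_series (R : realType) (beta : R) (lam : R[i]) (x : {i01 R}) :
    R[i]^o :=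
  limn (fun m => \sum_(1 <= n < m)
    ((digit beta n x)%:~R / (beta%:C ^+ n * lam ^+ n) : R[i]^o)).

Definition decay_matrix (R : realType) (beta : R) (N m : nat)
    (lam : 'I_N -> R[i]) (x : 'I_m -> {i01 R}) : 'M[R[i]]_(1 + N, m) :=
  col_mx (\row_j (x j)%:num%:C) (\matrix_(i, j) F_series beta (lam i) (x j)).

(* Main.v *)
From HB Require Import structures.
Require Import Defs.
From mathcomp Require Import all_boot all_order all_algebra.
From mathcomp Require Import cyclic separable cyclotomic.
From mathcomp Require Import complex.
From mathcomp Require Import all_classical all_reals all_analysis.
From mathcomp Require Import ring lra.

(** The indicators of the intervals [0,y] are almost stable under the transfer
operator L. Write e(y) for the class of the indicator of [0,y], a_n(y) for the
digits of y, T for the beta-map and b for beta. Then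
<<
  L e(y) = (a_1(y) e(1) + e(T y)) / b
>>
because the branches of T before the digit of y are full and the branch at the
digit is cut at T y ([PF_ind]). Everything is read off this identity.

Let F_y(z) be the sum of the a_n(y) (z / b)^n, so that F_y(1 / lambda) is the
function F_lambda of the statement, and let psi = 1 - F_1. Iterating, the
generating function of the L^n e(y) is the sum of the (z / b)^n e(T^n y) plus
F_y(z) / psi(z) times the sum of the (z / b)^n e(T^n 1). For the step function f
with coefficients c_i, put g as the sum of the c_i F_(x_i) and w = g / psi; then
L^n f is the sum of b^-n c_i e(T^n x_i) plus the sum over k of
w_k b^-(n-k) e(T^(n-k) 1) ([iter_PFhat]). As the e(y) have norm at most 2, it is
enough that the Taylor coefficients of w decay like rho^-n for some rho > 1 / M,
where M is the sub-leading modulus ([decay_of_coef_bound]), that is, that g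
vanishes at the zeros of psi in the disc of radius 1 / M and that these are
simple. The supremum M is finite because an eigenfunction is bounded off a
countable set ([eigenvalue_bound]).

Let psi vanish at z with |z| < b. The sum of the (z / b)^n 1_[0,T^n 1] is an
eigenfunction for 1 / z; it is not null because T^n 1 < 1 for n >= 1, so that
it is close to 1 near 1 ([orbit_sum_neq0], [root_eigenvalue]). Hence if
|z| <= 1 / M and z is not 1, then 1 / z is a sub-leading eigenvalue. If z is a
double zero, the sum of the (n + 1) (z / b)^n 1_[0,T^n 1] is a generalized
eigenfunction which is not an eigenfunction ([double_root_not_simple]), so the
simplicity of the eigenvalues gives that of the zeros; the zero 1 is
simple because the digits are nonnegative ([digit_series_deriv1]). The matrix
equation says that g vanishes at all these points: its first row is g(1) = 0,
since F_y(1) = y, and the others are g(1 / lambda_i) = 0.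

The complex analysis is reduced to absolutely convergent power series. A common
zero of g and psi is divided out without loss on the radius
([unlin_summable_large]). When no zero is left, |psi| is bounded below on a
slightly larger disc by compactness; for a polynomial truncation p of psi, the
series 1 / p is a product of geometric series since p splits into linear factors
with roots outside the disc, its coefficients are bounded by a Cauchy estimate
obtained by averaging over roots of unity ([cauchy_estimate]), and the n-th one
is that of 1 / psi as soon as p has degree at least n
([quotient_nonvanishing]). *)

Set Implicit Arguments.
Unset Strict Implicit.
Unset Printing Implicit Defensive.

Import Order.TTheory GRing.Theory Num.Theory.
Import numFieldNormedType.Exports.
Import ComplexField.Normc.
Local Open Scope classical_set_scope.
Local Open Scope ring_scope.
Local Open Scope complex_scope.

(** * Complex power series *)

(** The sum of the power series u at z. It is sealed, being meant to be used
through [ev_cvg] and [ev_unique]. *)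
HB.lock Definition ev (R : realType) (u : nat -> R[i]^o) (z : R[i]^o) : R[i]^o :=
  limn (series (fun n => u n * z ^+ n)).

Section ComplexSeries.
Variable R : realType.
Local Notation C := (R[i]^o).
Implicit Types (u v w : nat -> C) (z l a : C) (rho : R).

Lemma normrcE (z : R[i]) : `|z| = (normc z)%:C.
Proof. by rewrite normc_def; case: z. Qed.

Lemma normcX (z : R[i]) n : normc (z ^+ n) = normc z ^+ n.
Proof.
by elim: n => [|n IH]; rewrite ?expr0 ?normc1// !exprS normcM IH.
Qed.

Lemma normc_real (r : R) : normc r%:C = `|r|.
Proof. by rewrite /= expr0n addr0 sqrtr_sqr. Qed.

Lemma normc_eq0 (z : R[i]) : (normc z == 0) = (z == 0).
Proof. by apply/eqP/eqP => [/eq0_normc//|->]; rewrite normc0. Qed.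

Lemma normc_gt0 (z : R[i]) : (0 < normc z) = (z != 0).
Proof. by rewrite lt_def normc_eq0 normc_ge0 andbT. Qed.

Lemma normcB (z w : R[i]) : normc (z - w) = normc (w - z).
Proof. by rewrite -opprB normcN. Qed.

Lemma lerB_normc (z w : R[i]) : normc z - normc w <= normc (z - w).
Proof. by rewrite lerBlDr; have := le_normcD (z - w) w; rewrite subrK. Qed.

Lemma normc_sum (I : Type) (r : seq I) (P : pred I) (F : I -> R[i]) :
  normc (\sum_(i <- r | P i) F i) <= \sum_(i <- r | P i) normc (F i).
Proof.
elim/big_rec2: _ => [|i y x _ h]; first by rewrite normc0.
by apply: le_trans (le_normcD _ _) _; rewrite lerD2l.
Qed.

Lemma seriesS_sum (V : zmodType) (f : nat -> V) n :
  series f n.+1 = series f n + f n.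
Proof. by rewrite !seriesEnat /= big_nat_recr. Qed.

Lemma series0 (V : zmodType) (f : nat -> V) : series f 0%N = 0.
Proof. by rewrite seriesEnat /= big_geq. Qed.

(** The norm of the complex field is complex-valued; here the radius is real. *)
Lemma cvgcP (F : set_system nat) (FF : Filter F) u l :
  u @ F --> l <-> forall e : R, 0 < e -> \forall n \near F, normc (l - u n) < e.
Proof.
split=> [/cvgrPdist_lt h e e0|h].
  have /h : 0 < e%:C :> R[i] by rewrite ltcR.
  by apply: filterS => n; rewrite normrcE ltcR.
apply/cvgrPdist_lt => e e0.
have eE : e = (complex.Re e)%:C by move: e0; case: e => a b; rewrite ltcE /= => /andP[/eqP ->].
have /h : 0 < complex.Re e by move: e0; rewrite eE ltcR.
by apply: filterS => n; rewrite normrcE {2}eE ltcR.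
Qed.

Lemma cvg_normc u l : u @ \oo --> l -> (fun n => normc (u n)) @ \oo --> normc l.
Proof.
move=> /cvgcP h; apply/cvgrPdist_lt => e /h; apply: filterS => n; apply: le_lt_trans.
have h1 := le_normcD (l - u n) (u n); have h2 := le_normcD (u n - l) l.
rewrite subrK in h1; rewrite subrK normcB in h2.
by rewrite ler_norml; apply/andP; split; lra.
Qed.

Lemma cvgcB u l a : u @ \oo --> l -> (fun n => u n - a : C) @ \oo --> l - a.
Proof.
move=> /cvgcP h; apply/cvgcP => e /h; apply: filterS => n.
by rewrite opprB addrA subrK.
Qed.

Lemma cvgcD u v l l' : u @ \oo --> l -> v @ \oo --> l' ->
  (fun n => u n + v n : C) @ \oo --> l + l'.
Proof.
move=> /cvgcP ul /cvgcP vl'; apply/cvgcP => e e0.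
have e2 : 0 < e / 2 by rewrite divr_gt0.
near=> n; rewrite opprD addrACA.
apply: le_lt_trans (le_normcD _ _) _; rewrite [e]splitr.
by apply: ltrD; near: n; [exact: ul|exact: vl'].
Unshelve. all: by end_near. Qed.

Lemma cvgcZ a u l : u @ \oo --> l -> (fun n => a * u n : C) @ \oo --> a * l.
Proof.
move=> /cvgcP ul; apply/cvgcP => e e0.
have a0 : 0 < normc a + 1 by rewrite ltr_wpDl ?normc_ge0.
have /ul : 0 < e / (normc a + 1) by rewrite divr_gt0.
apply: filterS => n; rewrite ltr_pdivlMr// => h; rewrite -mulrBr normcM.
apply: le_lt_trans h; rewrite mulrC ler_wpM2l ?normc_ge0//.
by rewrite lerDl.
Qed.

Lemma cvgc_shift u l : u @ \oo --> l -> (fun n => u n.+1) @ \oo --> l.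
Proof. by move=> h; rewrite cvg_shiftS. Qed.

Lemma cvgc_unshift u l : (fun n => u n.+1) @ \oo --> l -> u @ \oo --> l.
Proof. by rewrite cvg_shiftS. Qed.

Lemma cvgc_cst a : (fun=> a) @ \oo --> (a : C).
Proof. by apply/cvgcP => e e0; apply: nearW => n; rewrite subrr normc0. Qed.

Lemma cvgc_sum (m : nat) (f : 'I_m -> nat -> C) (l : 'I_m -> C) :
  (forall i, f i @ \oo --> l i) ->
  (fun n => \sum_(i < m) f i n : C) @ \oo --> (\sum_(i < m) l i : C).
Proof.
elim: m f l => [|m IH] f l fl.
  rewrite big_ord0; under eq_fun do rewrite big_ord0; exact: cvgc_cst.
rewrite big_ord_recr; under eq_fun do rewrite big_ord_recr.
by apply: cvgcD => //; apply: IH.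
Qed.

Lemma cvg_normc_le u l a e : u @ \oo --> l ->
  (\forall n \near \oo, normc (u n - a) <= e) -> normc (l - a) <= e.
Proof.
move=> ul h; have {}ul := cvg_normc (cvgcB (a := a) ul).
exact: (@ler_cvg_to _ _ _ _ (fun n => normc (u n - a)) (fun=> e) _ _ ul (cvg_cst _) h).
Qed.

Lemma cvgc_unique u l l' : u @ \oo --> l -> u @ \oo --> l' -> l = l'.
Proof. by move=> h h'; rewrite -(cvg_lim _ h)// (cvg_lim _ h'). Qed.

Lemma cvg_complex (f g : nat -> R) (p q : R) : f @ \oo --> p -> g @ \oo --> q ->
  (fun n => f n +i* g n : C) @ \oo --> (p +i* q : C).
Proof.
move=> /cvgrPdist_lt fp /cvgrPdist_lt gq; apply/cvgcP => e e0.
have e2 : 0 < e / 2 by rewrite divr_gt0.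
near=> n.
have -> : (p +i* q) - (f n +i* g n) = (p - f n)%:C + 'i%C * (q - g n)%:C :> R[i].
  by rewrite [LHS]complexE.
apply: le_lt_trans (le_normcD _ _) _.
have ni : normc ('i%C : R[i]) = 1 by rewrite /= expr0n expr1n add0r sqrtr1.
rewrite normcM ni mul1r !normc_real [e]splitr ltrD//; near: n; [exact: fp|exact: gq].
Unshelve. all: by end_near. Qed.

(** Absolute convergence at radius rho, as a bound on partial sums: this form
passes directly through recurrences on coefficients. *)
Definition summable_at rho u :=
  exists B, forall m, series (fun n => normc (u n) * rho ^+ n) m <= B.

Lemma bounded_series_cvg (f : nat -> R) B : (forall n, 0 <= f n) ->
  (forall m, series f m <= B) -> cvgn (series f).
Proof.
move=> f0 fB; apply: nondecreasing_is_cvgn.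
  apply/nondecreasing_seqP => n.
  by rewrite !seriesEnat /= big_nat_recr//= lerDl.
by exists B => _ [m _ <-].
Qed.

(** The real and imaginary parts converge absolutely. *)
Lemma summable_cvg u : summable_at 1 u -> cvgn (series u).
Proof.
move=> [B uB].
have Bu m : series (fun n => normc (u n)) m <= B.
  apply: le_trans (uB m); rewrite le_eqVlt; apply/orP; left; apply/eqP.
  by rewrite !seriesEnat /=; apply: eq_bigr => i _; rewrite expr1n mulr1.
have part (p : C -> R) : (forall z, `|p z| <= normc z) ->
    cvgn (series (fun n => p (u n))).
  move=> pn; apply: normed_cvg; apply: (@bounded_series_cvg _ B) => [n|m].
    exact: normr_ge0.
  apply: le_trans (Bu m); rewrite !seriesEnat /=.
  by apply: ler_sum => i _; exact: pn.
have /cvg_ex[p hp] : cvgn (series (fun n => complex.Re (u n))).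
  apply: part => -[a b] /=; rewrite -sqrtr_sqr ler_wsqrtr// lerDl sqr_ge0//.
have /cvg_ex[q hq] : cvgn (series (fun n => complex.Im (u n))).
  apply: part => -[a b] /=; rewrite -sqrtr_sqr ler_wsqrtr// lerDr sqr_ge0//.
apply/cvg_ex; exists (p +i* q).
suff <- : (fun n => series (fun n => complex.Re (u n)) n +i*
    series (fun n => complex.Im (u n)) n : C) = series u by exact: cvg_complex.
apply/funext => n; rewrite !seriesEnat /=.
elim: n => [|n IH]; first by rewrite !big_geq.
by rewrite !big_nat_recr//= -IH; case: (u n).
Qed.

Lemma summable_at_ge0 rho u : 0 <= rho -> summable_at rho u ->
  exists2 B, 0 <= B & forall m, series (fun n => normc (u n) * rho ^+ n) m <= B.
Proof.
move=> r0 [B uB]; exists B => //; apply: le_trans (uB 0%N).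
by rewrite seriesEnat /= big_geq.
Qed.

Lemma summable_term rho u B : 0 <= rho ->
  (forall m, series (fun n => normc (u n) * rho ^+ n) m <= B) ->
  forall n, normc (u n) * rho ^+ n <= B.
Proof.
move=> r0 uB n; apply: le_trans (uB n.+1).
rewrite seriesEnat /= big_nat_recr//= lerDr; apply: sumr_ge0 => i _.
by rewrite mulr_ge0 ?normc_ge0 ?exprn_ge0.
Qed.

Lemma summable_le rho rho' u : 0 <= rho' <= rho ->
  summable_at rho u -> summable_at rho' u.
Proof.
move=> /andP[r0 rr] [B uB]; exists B => m; apply: le_trans (uB m).
rewrite !seriesEnat /=; apply: ler_sum => i _.
by rewrite ler_wpM2l ?normc_ge0// lerXn2r// ?nnegrE// (le_trans r0).
Qed.

Lemma ev_cvg rho u z : normc z <= rho -> summable_at rho u ->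
  series (fun n => u n * z ^+ n) @ \oo --> ev u z.
Proof.
move=> zr [B uB]; rewrite ev.unlock; apply: summable_cvg; exists B => m; apply: le_trans (uB m).
rewrite !seriesEnat /=; apply: ler_sum => i _.
rewrite expr1n mulr1 normcM normcX ler_wpM2l ?normc_ge0// lerXn2r// ?nnegrE ?normc_ge0//.
exact: le_trans (normc_ge0 _) zr.
Qed.

Lemma ev_unique u z l : series (fun n => u n * z ^+ n) @ \oo --> l -> ev u z = l.
Proof. by move=> h; rewrite ev.unlock; apply: cvg_lim. Qed.

Lemma ev0 u : ev u 0 = u 0%N.
Proof.
apply: ev_unique; apply: cvgc_unshift.
rewrite (_ : (fun n => _) = fun=> u 0%N); first exact: cvgc_cst.
apply/funext => n; rewrite seriesEnat /=; elim: n => [|n IH].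
  by rewrite big_nat1 expr0 mulr1.
by rewrite big_nat_recr//= IH expr0n mulr0 addr0.
Qed.

Lemma bounded_series_tail (f : nat -> R) B : (forall n, 0 <= f n) ->
  (forall m, series f m <= B) -> forall e, 0 < e ->
  exists m0, forall m k, (m0 <= m <= k)%N -> \sum_(m <= i < k) f i <= e.
Proof.
move=> f0 fB e e0; have cf := bounded_series_cvg f0 fB.
have nd : nondecreasing_seq (series f).
  by apply/nondecreasing_seqP => n; rewrite !seriesEnat /= big_nat_recr//= lerDl.
have /cvgrPdist_le/(_ _ e0)[m0 _ hm0] := cf.
exists m0 => m k /andP[mm mk].
have -> : \sum_(m <= i < k) f i = series f k - series f m.
  by rewrite !seriesEnat /= (big_cat_nat (leq0n m) mk)//= [RHS]addrC addKr.
have := hm0 m mm; rewrite ler_norml => /andP[_ h].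
have := nondecreasing_cvgn_le nd cf k; lra.
Qed.

(** The tail of the series of moduli bounds the error, uniformly on the disc. *)
Lemma ev_tail rho u : 0 <= rho -> summable_at rho u -> forall e, 0 < e ->
  exists m0, forall m z, (m0 <= m)%N -> normc z <= rho ->
    normc (ev u z - series (fun n => u n * z ^+ n) m) <= e.
Proof.
move=> r0 su e e0; have [B uB] := su.
have f0 n : 0 <= normc (u n) * rho ^+ n.
  by rewrite mulr_ge0 ?normc_ge0 ?exprn_ge0.
have [m0 tail] := bounded_series_tail f0 uB e0.
exists m0 => m z mm zr; apply: (cvg_normc_le (ev_cvg zr su)); near=> k.
have mk : (m <= k)%N by near: k; exact: nbhs_infty_ge.
rewrite !seriesEnat /= (big_cat_nat (leq0n m) mk)//= [X in normc X]addrC addKr.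
apply: le_trans (normc_sum _ _ _) _.
apply: le_trans (tail m k _); last by rewrite mm.
apply: ler_sum => i _; rewrite normcM normcX ler_wpM2l ?normc_ge0//.
by rewrite lerXn2r// ?nnegrE ?normc_ge0.
Unshelve. all: by end_near. Qed.

Lemma summable_mul_bounded rho u (b : nat -> C) D : 0 <= rho -> summable_at rho u ->
  (forall n, normc (b n) <= D) -> summable_at rho (fun n => u n * b n).
Proof.
move=> r0 [B uB] bD; have D0 : 0 <= D by exact: le_trans (normc_ge0 _) (bD 0%N).
exists (D * B) => m; apply: le_trans (ler_wpM2l D0 (uB m)).
rewrite !seriesEnat /= mulr_sumr; apply: ler_sum => i _.
rewrite normcM mulrA ler_wpM2r ?exprn_ge0// mulrC ler_wpM2r ?normc_ge0//.
Qed.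

Lemma summable_atZ rho a u : 0 <= rho -> summable_at rho u ->
  summable_at rho (fun n => a * u n).
Proof.
move=> r0 su; rewrite (_ : (fun n => _) = (fun n => u n * a)).
  exact: (summable_mul_bounded (D := normc a)).
by apply/funext => n; rewrite mulrC.
Qed.

Lemma summable_atD rho u v : 0 <= rho -> summable_at rho u -> summable_at rho v ->
  summable_at rho (fun n => u n + v n).
Proof.
move=> r0 [B uB] [B' vB]; exists (B + B') => m.
apply: le_trans (lerD (uB m) (vB m)).
rewrite !seriesEnat /= -big_split; apply: ler_sum => i _ /=.
by rewrite -mulrDl ler_wpM2r ?exprn_ge0 ?le_normcD.
Qed.

Lemma ev1_cvg u : summable_at 1 u -> series u @ \oo --> ev u 1.
Proof.
move=> su; have := @ev_cvg 1 u 1 _ su; rewrite normc1 lexx => /(_ isT).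
rewrite (_ : (fun n => u n * 1 ^+ n) = u)//.
by apply/funext => n; rewrite expr1n mulr1.
Qed.

Lemma summable1P u : summable_at 1 u <->
  exists B, forall m, series (fun n => normc (u n)) m <= B.
Proof.
have E : (fun n => normc (u n) * 1 ^+ n) = (fun n => normc (u n)).
  by apply/funext => n; rewrite expr1n mulr1.
by rewrite /summable_at E.
Qed.

Lemma ev_sum rho (m : nat) (c : 'I_m -> R[i]) (u : 'I_m -> nat -> C) a :
  normc a <= rho -> (forall i, summable_at rho (u i)) ->
  ev (fun k => \sum_i c i * u i k) a = \sum_i c i * ev (u i) a.
Proof.
move=> ar su; apply: ev_unique.
have := cvgc_sum (fun i => cvgcZ (a := c i) (ev_cvg ar (su i))).
set f := fun n => _.
suff -> : series (fun n => (\sum_i c i * u i n) * a ^+ n) = f by [].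
apply/funext; rewrite /f; elim=> [|n IH].
  by rewrite series0 big1// => i _; rewrite series0 mulr0.
rewrite seriesS_sum IH mulr_suml -big_split; apply: eq_bigr => i _ /=.
by rewrite seriesS_sum mulrDr mulrA.
Qed.

Lemma summable_sum rho (m : nat) (c : 'I_m -> R[i]) (u : 'I_m -> nat -> C) :
  0 <= rho -> (forall i, summable_at rho (u i)) ->
  summable_at rho (fun k => \sum_i c i * u i k).
Proof.
move=> r0; elim: m c u => [|m IH] c u su.
  exists 0 => n; rewrite seriesEnat /= big1// => i _.
  by rewrite big_ord0 normc0 mul0r.
rewrite (_ : (fun k => _) = fun k =>
    (\sum_(i < m) c (widen_ord (leqnSn m) i) * u (widen_ord (leqnSn m) i) k) +
    c ord_max * u ord_max k).
  by apply: summable_atD => //; [exact: IH|exact: summable_atZ].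
by apply/funext => k; rewrite big_ord_recr.
Qed.

(** Multiplied by (1 - q)^2, the partial sum telescopes. *)
Lemma arith_geo_bound (q : R) : 0 <= q < 1 -> forall m,
  series (fun n => n.+1%:R * q ^+ n) m <= (1 - q) ^- 2.
Proof.
move=> /andP[q0 q1] m.
have q1' : 0 < (1 - q) ^+ 2 by rewrite exprn_gt0// subr_gt0.
have E : (1 - q) ^+ 2 * series (fun n => n.+1%:R * q ^+ n) m =
    1 - q ^+ m * (1 + m%:R * (1 - q)).
  elim: m => [|m IH]; first by rewrite series0 mulr0 expr0 mul0r addr0 mul1r subrr.
  by rewrite seriesS_sum mulrDr IH [q ^+ m.+1]exprS -natr1; ring.
rewrite -[_ ^- 2]mul1r ler_pdivlMr// mulrC E lerBlDr lerDl.
by rewrite mulr_ge0 ?exprn_ge0// addr_ge0// mulr_ge0// subr_ge0 ltW.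
Qed.

Lemma summable_weight r s u B : 0 <= r < s ->
  (forall n, normc (u n) * s ^+ n <= B) ->
  summable_at r (fun n => n.+1%:R * u n).
Proof.
move=> /andP[r0 rs] uB; have s0 : 0 < s by exact: le_lt_trans rs.
have B0 : 0 <= B by have := uB 0%N; apply: le_trans; rewrite mulr_ge0 ?normc_ge0.
have q01 : 0 <= r / s < 1 by rewrite divr_ge0 ?(ltW s0)//= ltr_pdivrMr// mul1r.
exists (B * (1 - r / s) ^- 2) => m.
apply: le_trans (ler_wpM2l B0 (arith_geo_bound q01 m)).
rewrite !seriesEnat /= mulr_sumr; apply: ler_sum => n _.
have -> : normc (n.+1%:R * u n) = n.+1%:R * normc (u n).
  by rewrite normcM normcMn normc1.
rewrite -mulrA [leRHS]mulrCA ler_wpM2l//.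
have -> : r ^+ n = s ^+ n * (r / s) ^+ n.
  by rewrite -exprMn mulrCA divff ?mulr1 ?gt_eqF.
rewrite mulrA ler_wpM2r ?exprn_ge0//; by case/andP: q01.
Qed.

Lemma summable_geo r s u B : 0 <= r < s ->
  (forall n, normc (u n) * s ^+ n <= B) -> summable_at r u.
Proof.
move=> rs uB; have [D uD] := summable_weight rs uB.
exists D => m; apply: le_trans (uD m); rewrite !seriesEnat /=; apply: ler_sum => n _.
have -> : normc (n.+1%:R * u n) = n.+1%:R * normc (u n).
  by rewrite normcM normcMn normc1.
by case/andP: rs => r0 _; rewrite ler_wpM2r ?exprn_ge0// ler_peMl ?normc_ge0// ler1n.
Qed.

Lemma geo_weight_summable (q : C) : normc q < 1 ->
  summable_at 1 (fun n => q ^+ n) /\ summable_at 1 (fun n => n.+1%:R * q ^+ n).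
Proof.
move=> q1; have q0 := normc_ge0 q.
(* Any s > 1 with |q| s <= 1 will do; this one also exists for q = 0. *)
pose s := 2 / (1 + normc q); have q10 : 0 < 1 + normc q by lra.
have s1 : 1 < s by rewrite ltr_pdivlMr// mul1r; lra.
have s01 : (0 : R) <= 1 < s by rewrite ler01 s1.
have qB n : normc (q ^+ n) * s ^+ n <= 1.
  rewrite normcX -exprMn exprn_ile1//.
    by rewrite mulr_ge0// divr_ge0// ltW.
  by rewrite mulrA ler_pdivrMr// mul1r; lra.
by split; [exact: summable_geo qB|exact: summable_weight qB].
Qed.

(** These are the terms of a series which converges, because a smaller radius
absorbs a linear weight. *)
Lemma weighted_term_cvg0 r u a : normc a < r -> summable_at r u ->
  (fun n => n.+1%:R * u n * a ^+ n : C) @ \oo --> (0 : C).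
Proof.
move=> ar su; have r0 : 0 <= r by rewrite ltW// (le_lt_trans _ ar) ?normc_ge0.
have [B uB] := su.
have /(summable_weight (u := u))/(_ (summable_term r0 uB)) sw : 0 <= normc a < r.
  by rewrite normc_ge0.
have h := ev_cvg (lexx _) sw.
have := cvgcD (cvgc_shift h) (cvgcZ (a := -1) h).
rewrite mulN1r subrr; set f := fun n => _ + _.
suff -> : (fun n => n.+1%:R * u n * a ^+ n : C) = f by [].
by apply/funext => n; rewrite /f seriesS_sum mulN1r addrAC subrr add0r.
Qed.

End ComplexSeries.

(** * Products of formal series *)

Section FormalSeries.
Variable F : fieldType.
Implicit Types (u v w : nat -> F) (lam : F).

(** The Cauchy product; [lin] lam and [unlin] lam are the product and the quotient
by the series 1 - lam X. *)
Definition cprod u v n : F := \sum_(k < n.+1) u k * v (n - k)%N.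

Definition unit_series n : F := (n == 0%N)%:R.

Definition lin lam u n : F := u n - (if n is k.+1 then lam * u k else 0).

Fixpoint unlin lam u n : F :=
  if n is k.+1 then u n + lam * unlin lam u k else u 0%N.

Lemma unlinK lam u : lin lam (unlin lam u) = u.
Proof. by apply/funext => -[|n]; rewrite /lin /= ?subr0// addrK. Qed.

Lemma linC lam lam' u : lin lam (lin lam' u) = lin lam' (lin lam u).
Proof. by apply/funext => -[|[|n]]; rewrite /lin; ring. Qed.

Lemma unlin_partial lam u n : lam != 0 ->
  unlin lam u n = lam ^+ n * \sum_(0 <= k < n.+1) u k * lam^-1 ^+ k.
Proof.
move=> l0; elim: n => [|n IH] /=.
  by rewrite big_nat1 !expr0 mulr1 mul1r.
rewrite IH [in RHS]big_nat_recr//= mulrDr exprVn [in RHS]mulrCA.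
by rewrite divff ?expf_neq0// mulr1 mulrA -exprS addrC.
Qed.

(** The first n coefficients only depend on truncations, so that the ring laws of
polynomials apply. *)
Lemma cprod_coef (p q : {poly F}) u v n :
  (forall i, (i <= n)%N -> p`_i = u i) -> (forall i, (i <= n)%N -> q`_i = v i) ->
  cprod u v n = (p * q)`_n.
Proof.
move=> pu qv; rewrite coefM; apply: eq_bigr => k _.
by rewrite pu ?qv ?leq_subr// -ltnS.
Qed.

Let T n u := \poly_(i < n.+1) u i.

Let TE n u i : (i <= n)%N -> (T n u)`_i = u i.
Proof. by move=> h; rewrite coef_poly ltnS h. Qed.

Lemma cprodC u v : cprod u v = cprod v u.
Proof.
apply/funext => n; rewrite (@cprod_coef (T n u) (T n v))//; try exact: TE.
by rewrite (@cprod_coef (T n v) (T n u))// ?[T n v * _]mulrC//; exact: TE.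
Qed.

Lemma eq_cprod u u' v v' n : (forall i, (i <= n)%N -> u i = u' i) ->
  (forall i, (i <= n)%N -> v i = v' i) -> cprod u v n = cprod u' v' n.
Proof.
move=> uu vv; apply: eq_bigr => k _; congr (_ * _); first by rewrite uu// -ltnS.
by rewrite vv ?leq_subr.
Qed.

Lemma cprodA u v w : cprod u (cprod v w) = cprod (cprod u v) w.
Proof.
apply/funext => n.
rewrite (@cprod_coef (T n u) (T n v * T n w)) ?mulrA.
- apply/esym; apply: cprod_coef => i ni; last exact: TE.
  by apply/esym; apply: cprod_coef => j ji; apply: TE; exact: leq_trans ni.
- exact: TE.
- move=> i ni.
  by apply/esym; apply: cprod_coef => j ji; apply: TE; exact: leq_trans ni.
Qed.

Lemma cprod1 u : cprod u unit_series = u.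
Proof.
apply/funext => n; rewrite (@cprod_coef (T n u) 1) ?mulr1; first exact: TE.
- exact: TE.
- by move=> i _; rewrite coefC /unit_series; case: i.
Qed.

Lemma lin_coef lam (p : {poly F}) n :
  ((1 - lam *: 'X) * p)`_n = lin lam (fun i => p`_i) n.
Proof.
rewrite mulrBl mul1r coefB -scalerAl coefZ coefXM /lin.
by case: n => //=; rewrite mulr0.
Qed.

Lemma lin_cprod lam u v : cprod (lin lam u) v = lin lam (cprod u v).
Proof.
apply/funext => n.
have cv m : (m <= n)%N -> (T n u * T n v)`_m = cprod u v m.
  by move=> mn; apply/esym; apply: cprod_coef => i im; apply: TE;
    exact: leq_trans mn.
rewrite (@cprod_coef ((1 - lam *: 'X) * T n u) (T n v)).
- rewrite -mulrA lin_coef /lin cv//; case: n cv => //= n cv.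
  by rewrite cv.
- move=> i ni; rewrite lin_coef /lin TE//; case: i ni => //= i ni.
  by rewrite TE// ltnW.
- exact: TE.
Qed.

(** The product v p v' in degree n reads as v n or as v' n. *)
Lemma cprod_inv_unique p v v' n :
  (forall i, (i <= n)%N -> cprod p v i = unit_series i) ->
  (forall i, (i <= n)%N -> cprod p v' i = unit_series i) -> v n = v' n.
Proof.
move=> pv pv'; rewrite -[LHS]/(v n) -(cprod1 v).
rewrite -(@eq_cprod v v (cprod p v') unit_series)//.
by rewrite cprodA (@eq_cprod _ unit_series v' v')// 1?cprodC ?cprod1.
Qed.

End FormalSeries.

(** * Averages over roots of unity *)

Section PrimRoot.
Variable F : numClosedFieldType.

Lemma prim_root_exists n : (0 < n)%N -> exists z : F, n.-primitive_root z.
Proof.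
move=> n0; have [r rE] := closed_field_poly_normal ('X^n - 1 : {poly F}).
rewrite (monicP (monicXnsubC 1 n0)) scale1r in rE.
have rn : all n.-unity_root r.
  by apply/allP => z zr; rewrite /root_of_unity rE root_prod_XsubC.
have ur : uniq r.
  by rewrite -separable_prod_XsubC -rE separable_Xn_sub_1// pnatr_eq0 -lt0n.
have nr : (n <= size r)%N.
  by rewrite -ltnS -(size_prod_XsubC r id) -rE size_XnsubC.
by have /hasP[z _ zp] := has_prim_root n0 rn ur nr; exists z.
Qed.

(** For i different from j this is a geometric sum whose ratio, an n-th root of
unity, is not 1. *)
Lemma prim_root_sum n (w : F) (i j : nat) : n.-primitive_root w ->
  (i < n)%N -> (j < n)%N ->
  \sum_(k < n) w ^+ k ^+ i / w ^+ k ^+ j = n%:R *+ (i == j).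
Proof.
move=> wp lin ljn; have w0 : w != 0.
  apply: contra_eq_neq (prim_expr_order wp) => ->.
  by rewrite expr0n gtn_eqF ?(prim_order_gt0 wp)// eq_sym oner_eq0.
have [->|ij] := eqVneq i j.
  rewrite (eq_bigr (fun=> 1)) ?sumr_const ?card_ord// => k _.
  by rewrite divff// !expf_neq0.
set x := w ^+ i / w ^+ j.
have xE k : w ^+ k ^+ i / w ^+ k ^+ j = x ^+ k.
  by rewrite /x expr_div_n -!exprM !(mulnC k).
rewrite (eq_bigr (fun k : 'I_n => x ^+ k)) => [|k _]; last exact: xE.
have x1 : x != 1.
  apply/eqP => /divr1_eq /eqP; rewrite (eq_prim_root_expr wp) !modn_small//.
  exact/negP.
apply: (@mulfI _ (x - 1)); first by rewrite subr_eq0.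
rewrite -subrX1 mulr0 /x expr_div_n -!exprM !(mulnC _ n) !exprM.
by rewrite (prim_expr_order wp) !expr1n divr1 subrr.
Qed.

(** A discrete Fourier transform: averaging a polynomial over the points r w^k
isolates one coefficient. *)
Lemma prim_root_extract n (w r : F) (a : nat -> F) j : n.-primitive_root w ->
  (j < n)%N ->
  \sum_(k < n) (\sum_(i < n) a i * (r * w ^+ k) ^+ i) / w ^+ k ^+ j =
  n%:R * (a j * r ^+ j).
Proof.
move=> wp jn.
transitivity (\sum_(i < n)
    (a i * r ^+ i) * \sum_(k < n) (w ^+ k ^+ i / w ^+ k ^+ j)).
  rewrite (eq_bigr _ (fun i _ => mulr_sumr _ _ _ _)) exchange_big.
  apply: eq_bigr => k _; rewrite mulr_suml.
  by apply: eq_bigr => i _; rewrite exprMn !mulrA.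
rewrite (bigD1 (Ordinal jn))//= [X in _ + X]big1 ?addr0 => [|i ij].
  by rewrite (prim_root_sum wp)// eqxx mulrC.
rewrite (prim_root_sum wp)// (_ : (i == j :> nat) = false) ?mulr0//.
by apply: contraNF ij => /eqP h; apply/eqP/val_inj.
Qed.

End PrimRoot.

(** * Division by a linear factor *)

Section Division.
Variable R : realType.
Local Notation C := (R[i]^o).
Implicit Types (u v w : nat -> C) (z l a lam : C) (rho : R).

Lemma ev_lin lam rho u z : normc z <= rho -> summable_at rho u ->
  ev (lin lam u) z = (1 - lam * z) * ev u z.
Proof.
move=> zr su; apply: ev_unique; apply: cvgc_unshift.
have uE := ev_cvg zr su.
have := cvgcD (cvgc_shift uE) (cvgcZ (a := - (lam * z)) uE).
rewrite -{1}[ev u z]mul1r -mulrDl; set f := fun n => _.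
suff -> : (fun n => series (fun n => lin lam u n * z ^+ n) n.+1) = f by [].
apply/funext => n; rewrite /f.
elim: n => [|n IH].
  by rewrite !seriesS_sum !series0 mulr0 addr0 /lin subr0.
rewrite seriesS_sum IH !seriesS_sum /lin !exprS.
ring.
Qed.

Lemma lin_summable lam rho u : 0 <= rho ->
  summable_at rho u -> summable_at rho (lin lam u).
Proof.
move=> r0 /(summable_at_ge0 r0)[B B0 uB].
have lB n : series (fun n => normc (lin lam u n) * rho ^+ n) n.+1 <=
    series (fun n => normc (u n) * rho ^+ n) n.+1 +
    normc lam * rho * series (fun n => normc (u n) * rho ^+ n) n.
  elim: n => [|n IH]; rewrite seriesS_sum.
    by rewrite !seriesS_sum !series0 mulr0 addr0 /lin subr0.
  apply: le_trans (lerD IH (lexx _)) _.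
  rewrite [in leRHS]seriesS_sum [X in _ <= _ + _ * X]seriesS_sum.
  have : normc (lin lam u n.+1) * rho ^+ n.+1 <=
     normc (u n.+1) * rho ^+ n.+1 + normc lam * rho * (normc (u n) * rho ^+ n).
    rewrite /lin; apply: le_trans (ler_wpM2r _ (le_normcD _ _)) _.
      by rewrite exprn_ge0.
    rewrite normcN normcM mulrDl lerD2l exprS le_eqVlt.
    by apply/orP; left; apply/eqP; ring.
  rewrite mulrDr; lra.
exists (B + normc lam * rho * B) => -[|m].
  by rewrite series0 addr_ge0// !mulr_ge0 ?normc_ge0.
by apply: le_trans (lB m) _; rewrite lerD// ler_wpM2l// mulr_ge0 ?normc_ge0.
Qed.

(** The partial sums S satisfy S_(n+1) <= U_(n+1) + q S_n, with U those of u and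
q = |lam| rho < 1. *)
Lemma unlin_summable_small lam rho u : 0 <= rho -> normc lam * rho < 1 ->
  summable_at rho u -> summable_at rho (unlin lam u).
Proof.
move=> r0 lr [B uB]; set q := normc lam * rho in lr.
have q0 : 0 <= q by rewrite mulr_ge0 ?normc_ge0.
have q1 : 0 < 1 - q by rewrite subr_gt0.
have B0 : 0 <= B by apply: le_trans (uB 0%N); rewrite series0.
exists (B / (1 - q)).
pose S := series (fun n => normc (unlin lam u n) * rho ^+ n).
pose t n := normc (unlin lam u n) * rho ^+ n.
pose U := series (fun n => normc (u n) * rho ^+ n).
have SE n : S n.+1 = S n + t n by exact: seriesS_sum.
have UE n : U n.+1 = U n + normc (u n) * rho ^+ n by exact: seriesS_sum.
(* |unlin_(n+1)| <= |u_(n+1)| + |lam| |unlin_n|, summed up to n. *)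
have rec n : S n.+1 <= U n.+1 + q * S n.
  elim: n => [|n IH]; first by rewrite SE UE /S /U !series0 mulr0 addr0.
  have qS : q * S n.+1 = q * S n + q * t n by rewrite SE mulrDr.
  have : t n.+1 <= normc (u n.+1) * rho ^+ n.+1 + q * t n.
    rewrite /t /= /q exprS.
    have /ler_wpM2r := le_normcD (u n.+1) (lam * unlin lam u n).
    move=> /(_ (rho * rho ^+ n)); rewrite mulr_ge0 ?exprn_ge0// => /(_ isT).
    by rewrite normcM mulrDl => /le_trans; apply; rewrite lerD2l le_eqVlt;
      apply/orP; left; apply/eqP; ring.
  by move: IH; rewrite (SE n.+1) (UE n.+1) qS; lra.
elim=> [|n IH]; first by rewrite series0 divr_ge0// ltW.
apply: le_trans (rec n) _; apply: (@le_trans _ _ (B + q * (B / (1 - q)))).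
  by rewrite lerD ?ler_wpM2l.
by rewrite le_eqVlt; apply/orP; left; apply/eqP; field; rewrite gt_eqF.
Qed.

(** At a zero 1 / lam of the sum, the partial sums which define the quotient are
minus the corresponding tails. Hence dividing by 1 - lam X keeps the radius,
although the zero lies inside the disc. *)
Lemma unlin_summable_large lam rho u : 0 < rho -> 1 < normc lam * rho ->
  summable_at rho u -> ev u lam^-1 = 0 -> summable_at rho (unlin lam u).
Proof.
move=> r0 lr su u0; have [B B0 uB] := summable_at_ge0 (ltW r0) su.
set q := normc lam * rho in lr.
have lam0 : lam != 0.
  rewrite -normc_gt0 lt_def normc_ge0 andbT.
  by apply: contraTneq lr; rewrite /q => ->; rewrite mul0r -leNgt ler01.
have nl0 : 0 < normc lam by rewrite normc_gt0.
have linv : normc lam^-1 <= rho.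
  by rewrite normcV// -[leLHS]mul1r ler_pdivrMr// mulrC ltW.
have term n : normc (unlin lam u n) * rho ^+ n <= B.
  rewrite unlin_partial// normcM normcX mulrAC -exprMn -/q.
  have qn0 : 0 < q ^+ n by rewrite exprn_gt0// (lt_trans ltr01).
  rewrite mulrC -ler_pdivlMr//.
  have -> : normc (series (fun k => u k * lam^-1 ^+ k) n.+1) =
      normc (0 - series (fun k => u k * lam^-1 ^+ k) n.+1).
    by rewrite sub0r normcN.
  rewrite -u0; apply: (cvg_normc_le (ev_cvg linv su)); near=> m.
  have nm : (n.+1 <= m)%N by near: m; exact: nbhs_infty_ge.
  rewrite !seriesEnat /= (big_cat_nat (leq0n n.+1) nm)//= [X in normc X]addrC addKr.
  apply: le_trans (normc_sum _ _ _) _; rewrite ler_pdivlMr// mulr_suml.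
  apply: le_trans (uB m); rewrite seriesEnat /= [leRHS](big_cat_nat (leq0n n.+1) nm)//=.
  apply: (@le_trans _ _ (\sum_(n.+1 <= i < m) normc (u i) * rho ^+ i)); last first.
    by rewrite lerDr sumr_ge0// => i _; rewrite mulr_ge0 ?normc_ge0 ?exprn_ge0 ?ltW.
  apply: ler_sum_nat => i /andP[ni _].
  rewrite normcM normcX -mulrA ler_wpM2l ?normc_ge0//.
  rewrite normcV// -[rho in leRHS](mulKf (lt0r_neq0 nl0)) -/q [leRHS]exprMn ler_wpM2l//.
    by rewrite exprn_ge0// invr_ge0 ltW.
  by rewrite ler_eXn2l// ltnW.
have q1 : 0 < q - 1 by rewrite subr_gt0.
exists ((B + B) / (q - 1)) => m.
pose S := series (fun n => normc (unlin lam u n) * rho ^+ n).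
pose t n := normc (unlin lam u n) * rho ^+ n.
pose U := series (fun n => normc (u n) * rho ^+ n).
have SE n : S n.+1 = S n + t n by exact: seriesS_sum.
have UE n : U n.+1 = U n + normc (u n) * rho ^+ n by exact: seriesS_sum.
(* The recurrence read backwards, |lam| |unlin_n| <= |unlin_(n+1)| + |u_(n+1)|. *)
have rec n : q * S n <= S n.+1 + U n.+1.
  elim: n => [|n IH].
    by rewrite SE UE /S /U !series0 mulr0 !add0r addr_ge0// mulr_ge0 ?normc_ge0 ?exprn_ge0 ?ltW.
  have qS : q * S n.+1 = q * S n + q * t n by rewrite SE mulrDr.
  have : q * t n <= t n.+1 + normc (u n.+1) * rho ^+ n.+1.
    have := le_normcD (u n.+1 + lam * unlin lam u n) (- u n.+1).
    rewrite [X in normc X <= _]addrAC subrr add0r normcM normcN.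
    have /ler_wpM2r h := exprn_ge0 n.+1 (ltW r0).
    move=> /h; rewrite mulrDl; apply: le_trans.
    by rewrite /t /q exprS le_eqVlt; apply/orP; left; apply/eqP; ring.
  by move: IH; rewrite (SE n.+1) (UE n.+1) qS; lra.
rewrite ler_pdivlMr// -/(S m).
have := rec m; rewrite SE.
have := term m; have := uB m.+1; rewrite -/(t m) -/(U m.+1); lra.
Unshelve. all: by end_near. Qed.

(** A double zero a of lin a^-1 chi, that is a zero of chi, is a zero of the
derivative: the partial sums telescope to (n + 1) chi_n a^n minus
those of chi at a. *)
Lemma double_zero_deriv rho chi a : a != 0 -> normc a < rho ->
  summable_at rho chi -> ev chi a = 0 ->
  series (fun n => n%:R * lin a^-1 chi n * a ^+ n) @ \oo --> (0 : C).
Proof.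
move=> a0 ar schi chia; apply: cvgc_unshift.
have h := cvgc_shift (ev_cvg (ltW ar) schi).
have := cvgcD (weighted_term_cvg0 ar schi) (cvgcZ (a := -1) h).
rewrite chia mulr0 addr0; set f := fun n => _ + _.
suff -> : (fun n => series (fun n => n%:R * lin a^-1 chi n * a ^+ n) n.+1) = f by [].
apply/funext => n; rewrite /f mulN1r; elim: n => [|n IH].
  by rewrite !seriesS_sum !series0 !mul0r !add0r mul1r subrr.
rewrite seriesS_sum IH [X in _ = _ - X]seriesS_sum /lin exprS.
have -> : n.+1%:R * (chi n.+1 - a^-1 * chi n) * (a * a ^+ n) =
    n.+1%:R * chi n.+1 * (a * a ^+ n) - n.+1%:R * chi n * a ^+ n * (a^-1 * a).
  by ring.
rewrite mulVf// mulr1 -[n.+2%:R]natr1; ring.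
Qed.

Lemma unit_summable rho : 0 <= rho -> summable_at rho (@unit_series R[i]).
Proof.
move=> r0; apply: (@summable_geo _ rho (rho + 1) _ 1) => [|n].
  by rewrite r0 ltrDl ltr01.
case: n => [|n]; first by rewrite /unit_series eqxx normc1 mulr1.
by rewrite /unit_series normc0 mul0r.
Qed.

Lemma ev_unit z : ev (@unit_series _) z = 1.
Proof.
apply: ev_unique; apply: cvgc_unshift.
rewrite (_ : (fun n => _) = fun=> 1); first exact: cvgc_cst.
apply/funext => n; elim: n => [|n IH]; rewrite seriesS_sum.
  by rewrite series0 add0r expr0 mulr1.
by rewrite IH /unit_series mul0r addr0.
Qed.

End Division.

(** * Coefficients of a quotient of power series *)

Section Quotient.
Variable R : realType.
Local Notation C := (R[i]^o).
Implicit Types (u v w : nat -> C) (z l a lam : C) (rho : R).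

(** The Cauchy estimate. A partial sum is close to the sum on the whole circle, and
averaging it over the points rho x^k, for x a primitive root of unity of large
order, isolates the n-th coefficient. *)
Lemma cauchy_estimate rho v B : 0 < rho -> summable_at rho v ->
  (forall z, normc z = rho -> normc (ev v z) <= B) ->
  forall n, normc (v n) * rho ^+ n <= B.
Proof.
move=> r0 sv vB n; apply/ler_addgt0Pr => e e0.
have [m0 tail] := ev_tail (ltW r0) sv e0.
pose m := maxn m0 n.+1.
have nm : (n < m)%N by rewrite leq_maxr.
have m_gt0 : (0 < m)%N by exact: leq_ltn_trans nm.
have [x xp] := @prim_root_exists R[i] m m_gt0.
have x1 : normc x = 1.
  apply/eqP; rewrite -(@pexpr_eq1 _ _ m)// ?normc_ge0// -normcX.
  by rewrite (prim_expr_order xp) normc1.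
have pB k : normc (\sum_(i < m) v i * (rho%:C * x ^+ k) ^+ i) <= B + e.
  have zr : normc (rho%:C * x ^+ k) = rho.
    by rewrite normcM normcX x1 expr1n mulr1 normc_real gtr0_norm.
  have := tail m (rho%:C * x ^+ k) (leq_maxl _ _); rewrite zr => /(_ (lexx _)).
  rewrite seriesEnat /= big_mkord; set p := \sum_(i < m) _.
  have := vB _ zr; set l := ev _ _ => h1 h2.
  have := le_normcD (p - l) l; rewrite subrK normcB; lra.
have key := prim_root_extract (rho%:C) v xp nm.
have : normc (m%:R * (v n * rho%:C ^+ n)) <= m%:R * (B + e).
  rewrite -key; apply: le_trans (normc_sum _ _ _) _.
  rewrite mulr_natl -[m in _ *+ m]card_ord -sumr_const; apply: ler_sum => k _.
  by rewrite normcM normcV -!exprM !normcX x1 expr1n invr1 mulr1.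
have nmR : normc (m%:R : R[i]) = m%:R by rewrite normcMn normc1.
rewrite !normcM nmR normcX normc_real gtr0_norm// ler_pM2l// ltr0n//.
Qed.

(** The polynomial is a product of factors 1 - X / z with |z| > rho, whose inverses
are geometric series summable at rho. *)
Lemma poly_inverse rho (p : {poly R[i]}) : 0 <= rho -> p`_0 = 1 ->
  (forall z, normc z <= rho -> p.[z] != 0) ->
  exists v, [/\ summable_at rho v, cprod (fun i : nat => p`_i) v = @unit_series R[i] &
    forall z, normc z <= rho -> p.[z] * ev v z = 1].
Proof.
move=> r0 p0 pnz; have [r rE] := closed_field_poly_normal p.
have lc0 : lead_coef p != 0.
  by rewrite lead_coef_eq0; apply: contra_eq_neq p0 => ->;
    rewrite coef0 eq_sym oner_eq0.
have rootr z : root p z = (z \in r) by rewrite {1}rE rootZ// root_prod_XsubC.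
have r_gt z : z \in r -> rho < normc z.
  rewrite -rootr => /rootP pz; rewrite ltNge; apply/negP => /pnz.
  by rewrite pz eqxx.
have pE : p = \prod_(z <- r) (1 - z^-1 *: 'X).
  have : p = (lead_coef p * \prod_(z <- r) (- z)) *: \prod_(z <- r) (1 - z^-1 *: 'X).
    rewrite {1}rE -scalerA; congr (_ *: _).
    rewrite -mul_polyC rmorph_prod -big_split /= !big_seq; apply: eq_bigr => z zr.
    rewrite polyCN mulNr mulrBr mulr1 opprB mul_polyC scalerA divff ?scale1r//.
    by rewrite -normc_gt0; apply: le_lt_trans (r_gt z zr).
  set k := (X in X *: _) => pk.
  have k1 : k = 1.
    move: p0; rewrite pk coefZ -horner_coef0 horner_prod big1 ?mulr1// => z _.
    by rewrite !hornerE /= ?mulr0 ?subr0.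
  by rewrite {1}pk k1 scale1r.
rewrite pE; elim: r r_gt {p p0 pnz rE lc0 rootr pE} => [|z r IH] r_gt.
  exists (@unit_series _); rewrite big_nil; split.
  - exists 1; case=> [|m]; first by rewrite series0.
    suff -> : series (fun n => normc (@unit_series R[i] n) * rho ^+ n) m.+1 = 1 by [].
    elim: m => [|m IH]; rewrite seriesS_sum ?IH ?series0 /unit_series.
      by rewrite eqxx normc1 mulr1 add0r.
    by rewrite normc0 mul0r addr0.
  - by rewrite cprod1; apply/funext => i; rewrite coef1.
  - by move=> x _; rewrite hornerC mul1r ev_unit.
have [|v [sv pv evv]] := IH; first by move=> x xr; apply: r_gt; rewrite inE xr orbT.
have z_small : normc z^-1 * rho < 1.
  have rz : rho < normc z by apply: r_gt; rewrite inE eqxx.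
  by rewrite normcV mulrC ltr_pdivrMr ?mul1r//; exact: le_lt_trans rz.
have sw := unlin_summable_small r0 z_small sv.
exists (unlin z^-1 v); rewrite big_cons; split=> //.
- rewrite (_ : (fun i : nat => _) = lin z^-1 (fun i => (\prod_(j <- r) (1 - j^-1 *: 'X))`_i)).
    by rewrite lin_cprod cprodC -lin_cprod unlinK cprodC.
  by apply/funext => i; rewrite lin_coef.
- move=> x xr; have := ev_lin z^-1 xr sw; rewrite unlinK => h.
  rewrite -(evv x xr) h hornerM hornerD hornerN hornerC hornerZ hornerX.
  by rewrite [in RHS]mulrCA mulrA.
Qed.

(** A partial sum, which is Lipschitz on the disc, approximates the sum uniformly. *)
Lemma ev_continuous rho u z : 0 < rho -> summable_at rho u -> normc z <= rho ->
  forall e, 0 < e -> exists2 d, 0 < d & forall x, normc x <= rho ->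
    normc (x - z) < d -> normc (ev u x - ev u z) < e.
Proof.
move=> r0 su zr e e0.
have e4 : 0 < e / 4 by rewrite divr_gt0.
have e34 : e / 4 + e / 4 + e / 4 < e by lra.
have [m tail] := ev_tail (ltW r0) su e4.
pose P x := series (fun n => u n * x ^+ n) m.
have [d d0 Pd] : exists2 d, 0 < d & forall x, normc x <= rho ->
    normc (x - z) < d -> normc (P x - P z) <= e / 4.
  pose L := series (fun n => normc (u n) * (rho ^+ n.-1 *+ n)) m.
  have L0 : 0 <= L.
    rewrite /L seriesEnat /=; apply: sumr_ge0 => i _.
    by rewrite mulr_ge0 ?normc_ge0// mulrn_wge0// exprn_ge0 ?ltW.
  have L1 : 0 < L + 1 by rewrite ltr_wpDl.
  exists (e / 4 / (L + 1)); first by rewrite divr_gt0.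
  move=> x xr; rewrite ltr_pdivlMr// => /ltW xz.
  apply: (@le_trans _ _ (L * normc (x - z))); last first.
    by apply: le_trans xz; rewrite mulrC ler_wpM2l ?normc_ge0// lerDl.
  rewrite /P /L !seriesEnat /= -sumrB mulr_suml.
  apply: le_trans (normc_sum _ _ _) _; apply: ler_sum => n _.
  rewrite -mulrBr normcM -mulrA ler_wpM2l ?normc_ge0//.
  rewrite subrXX normcM mulrC ler_wpM2r ?normc_ge0//.
  apply: le_trans (normc_sum _ _ _) _.
  rewrite -[n in _ *+ n]card_ord -sumr_const; apply: ler_sum => i _.
  rewrite normcM !normcX.
  have iE : (n.-1 - i + i = n.-1)%N.
    by rewrite subnK// -ltnS prednK// (leq_ltn_trans _ (ltn_ord i)).
  rewrite -[in leRHS]iE.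
  have le_pow y k : normc y <= rho -> normc y ^+ k <= rho ^+ k.
    by move=> yr; rewrite lerXn2r// ?nnegrE ?normc_ge0// ltW.
  by rewrite exprD ler_pM ?exprn_ge0 ?normc_ge0 ?le_pow.
exists d => // x xr xz.
have h1 := tail m x (leqnn _) xr; have h2 := tail m z (leqnn _) zr.
have h3 := Pd x xr xz.
rewrite -/(P x) in h1; rewrite -/(P z) normcB in h2.
have -> : ev u x - ev u z = (ev u x - P x) + (P x - P z) + (P z - ev u z).
  by rewrite !addrA !subrK.
apply: le_lt_trans (le_normcD _ _) _.
apply: le_lt_trans e34.
by apply: lerD h2; apply: le_trans (le_normcD _ _) (lerD h1 h3).
Qed.

(** Compactness of the closed disc of radius r. The lower bound and the excess over
r are the same parameter d, so that both come from one statement near d = 0. *)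
Lemma nonvanishing_lower_bound r rho u : 0 < r < rho -> summable_at rho u ->
  (forall z, normc z <= r -> ev u z != 0) ->
  exists d : R, [/\ 0 < d, r + d < rho &
    forall z, normc z <= r + d -> d <= normc (ev u z)].
Proof.
move=> /andP[r0 rr] su unz; have rho0 : 0 < rho by exact: lt_trans rr.
pose K := (`[- rho, rho] `*` `[- rho, rho] : set (R * R)).
have cK : compact K by apply: compact_setX; exact: segment_compact.
pose P (d : R) (x : R * R) :=
  normc (x.1 +i* x.2) <= r + d -> d <= normc (ev u (x.1 +i* x.2)).
have near_ball (x : R * R) (e : R) : 0 < e ->
    \forall y \near x, normc ((y.1 +i* y.2) - (x.1 +i* x.2) : R[i]) < e.
  move=> e0; have e2 : 0 < e / 2 by rewrite divr_gt0.
  have h1 : \forall y \near x, `|x.1 - y.1| < e / 2.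
    by apply: (@cvgr_dist_lt _ _ _ (nbhs x) _ fst) => //; exact: cvg_fst.
  have h2 : \forall y \near x, `|x.2 - y.2| < e / 2.
    by apply: (@cvgr_dist_lt _ _ _ (nbhs x) _ snd) => //; exact: cvg_snd.
  apply: filterS2 h1 h2 => y y1 y2.
  have -> : (y.1 +i* y.2) - (x.1 +i* x.2) = (y.1 - x.1)%:C + 'i%C * (y.2 - x.2)%:C :> R[i].
    by rewrite [LHS]complexE.
  apply: le_lt_trans (le_normcD _ _) _.
  have ni : normc ('i%C : R[i]) = 1 by rewrite /= expr0n expr1n add0r sqrtr1.
  rewrite normcM ni mul1r !normc_real distrC [`|y.2 - _|]distrC; lra.
have /compact_near_coveringP cov := cK.
have : \forall d \near 0^'+, K `<=` P d.
  apply: cov => -[a b] _.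
  have [zr|zr] := leP (normc (a +i* b)) r; last first.
    pose h := (normc (a +i* b) - r) / 2.
    have h0 : 0 < h by rewrite divr_gt0// subr_gt0.
    have hd : \forall d \near 0^'+, d < h by exact: nbhs_right_lt.
    near=> y d => /=.
    have yz : normc ((y.1 +i* y.2) - (a +i* b) : R[i]) < h.
      by near: y; exact: (near_ball (a, b)).
    have dh : d < h by near: d.
    rewrite /P => yr; exfalso.
    have := le_normcD ((a +i* b) - (y.1 +i* y.2) : R[i]) (y.1 +i* y.2).
    rewrite subrK normcB; move: yz yr dh; rewrite /h; lra.
  have c0 : 0 < normc (ev u (a +i* b)) by rewrite normc_gt0 unz.
  set c := normc (ev u (a +i* b)) in c0.
  have c2 : 0 < c / 2 by rewrite divr_gt0.
  have [h h0 hc] := ev_continuous rho0 su (le_trans zr (ltW rr)) c2.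
  have hd : \forall d \near 0^'+, d < c / 2 by exact: nbhs_right_lt.
  have hr : \forall d \near 0^'+, d < rho - r.
    by apply: nbhs_right_lt; rewrite subr_gt0.
  near=> y d => /=.
  have yz : normc ((y.1 +i* y.2) - (a +i* b) : R[i]) < h.
    by near: y; exact: (near_ball (a, b)).
  have dc : d < c / 2 by near: d.
  have dr : d < rho - r by near: d.
  rewrite /P => yr.
  have yrho : normc (y.1 +i* y.2) <= rho by move: yr dr; lra.
  have := le_lt_trans (lerB_normc (ev u (a +i* b)) (ev u (y.1 +i* y.2))).
  rewrite normcB => /(_ _ (hc _ yrho yz)).
  rewrite -/c ltrBlDr -ltrBlDl {1}[c]splitr addrK => /ltW.
  by apply: le_trans; exact: ltW.
move=> H.
have hd : \forall d \near 0^'+, 0 < d :> R by exact: nbhs_right_gt.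
have hr : \forall d \near 0^'+, d < rho - r.
  by apply: nbhs_right_lt; rewrite subr_gt0.
have [d [dP d0 dr]] : exists d, [/\ K `<=` P d, 0 < d & d < rho - r].
  apply: (@filter_ex _ (0^'+ : set_system R) _).
  by apply: filterS3 H hd hr.
exists d; split => //; first by rewrite addrC -ltrBrDr.
move=> [a b] zr; apply: (dP (a, b)) => //.
have ab : normc (a +i* b) <= rho by move: zr dr; lra.
have le_re : `|a| <= normc (a +i* b) by rewrite /= -sqrtr_sqr ler_wsqrtr// lerDl sqr_ge0.
have le_im : `|b| <= normc (a +i* b) by rewrite /= -sqrtr_sqr ler_wsqrtr// lerDr sqr_ge0.
by split=> /=; rewrite in_itv /= -ler_norml; [apply: le_trans le_re _|apply: le_trans le_im _].
Unshelve. all: by end_near. Qed.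

Lemma summable_coef_bound rho u v B B' : 0 <= rho ->
  (forall m, series (fun n => normc (u n) * rho ^+ n) m <= B) -> 0 <= B' ->
  (forall n, normc (v n) * rho ^+ n <= B') ->
  forall n, normc (cprod u v n) * rho ^+ n <= B * B'.
Proof.
move=> r0 uB B'0 vB n.
apply: (@le_trans _ _ (series (fun n => normc (u n) * rho ^+ n) n.+1 * B')); last first.
  exact: ler_wpM2r.
rewrite seriesEnat /= big_mkord mulr_suml.
apply: le_trans (ler_wpM2r (exprn_ge0 n r0) (normc_sum _ _ _)) _.
rewrite mulr_suml; apply: ler_sum => k _.
rewrite normcM -mulrA -mulrA ler_wpM2l ?normc_ge0//.
have -> : rho ^+ n = rho ^+ (n - k) * rho ^+ k by rewrite -exprD subnK// -ltnS.
by rewrite mulrA mulrC ler_wpM2l ?exprn_ge0.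
Qed.

(** The n-th coefficient of 1 / psi is that of 1 / p for every truncation p of psi
of degree at least n. For long truncations |p| has the same positive lower bound
on the disc, whence by the Cauchy estimate a bound on the coefficients of 1 / p
which does not depend on the truncation. *)
Lemma quotient_nonvanishing r rho psi g : 0 < r < rho ->
  summable_at rho psi -> summable_at rho g -> psi 0%N = 1 ->
  (forall z, normc z <= r -> ev psi z != 0) ->
  exists w rho' B, [/\ r < rho' <= rho, cprod w psi = g &
    forall n, normc (w n) * rho' ^+ n <= B].
Proof.
move=> /[dup] rr /andP[r0 _] spsi sg psi0 psinz.
have [d [d0 rd dP]] := nonvanishing_lower_bound rr spsi psinz.
have rd0 : 0 < r + d by rewrite addr_gt0.
have d2 : 0 < d / 2 by rewrite divr_gt0.
have [m0 tail] := ev_tail (ltW (lt_trans rd0 rd)) spsi d2.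
pose p n := \poly_(i < (maxn n m0).+1) psi i : {poly R[i]}.
have pP n z : normc z <= r + d -> d / 2 <= normc (p n).[z].
  move=> zr; have := tail (maxn n m0).+1 z.
  rewrite leqW ?leq_maxr// (le_trans zr (ltW rd)) => /(_ isT isT).
  rewrite seriesEnat /= big_mkord /p horner_poly.
  set q := \sum_(i < _) _; have := dP z zr.
  have := le_normcD (ev psi z - q) q; rewrite subrK; lra.
have pcoef n i : (i <= n)%N -> (p n)`_i = psi i.
  by move=> ni; rewrite coef_poly ltnS (leq_trans ni) ?leq_maxl.
have invP n : exists v,
    (forall i, (i <= n)%N -> cprod psi v i = unit_series R[i] i) /\
    forall k, normc (v k) * (r + d) ^+ k <= 2 / d.
  have [| |v [sv pv ev1]] := @poly_inverse (r + d) (p n) (ltW rd0).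
  - by rewrite pcoef// psi0.
  - by move=> z /(pP n) h; rewrite -normc_gt0; apply: lt_le_trans h.
  exists v; split=> [i ni|k].
    rewrite -pv; apply: eq_cprod => // j ji.
    by rewrite pcoef// (leq_trans ji).
  apply: cauchy_estimate => // z zr.
  have zr' : normc z <= r + d by rewrite zr.
  have := congr1 (@normc R) (ev1 z zr'); rewrite normcM normc1.
  have := pP n z zr'; set x := normc _; set y := normc (ev v z) => xd xy.
  rewrite -(ler_pM2l d2) (_ : d / 2 * (2 / d) = 1); last by field; rewrite gt_eqF.
  by rewrite -[leRHS]xy ler_wpM2r// normc_ge0.
have [v vP] := choice invP.
(* The inverse up to degree n of psi; the diagonal inverts psi in all degrees. *)
pose V n := v n n.
have psiV : cprod psi V = unit_series R[i].
  apply/funext => n; rewrite -(vP n).1//; apply: eq_cprod => // i ni.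
  apply: (@cprod_inv_unique _ psi (v i) (v n) i) => j ji; first exact: (vP i).1.
  by apply: (vP n).1; exact: leq_trans ni.
have rdrho : 0 <= r + d <= rho by rewrite !ltW.
have [B gB] := summable_le rdrho sg.
exists (cprod g V), (r + d), (B * (2 / d)); split.
- by rewrite ltrDl d0 ltW.
- by rewrite -cprodA (cprodC V) psiV cprod1.
- apply: summable_coef_bound => //; first exact: ltW.
    by rewrite divr_ge0// ltW.
  by move=> n; apply: (vP n).2.
Qed.

(** Induction on the zeros: at a simple zero of psi over a zero of g, both series
are divided by the same linear factor. Simplicity is the statement that the
quotient of psi by the factor does not vanish again, which survives the division
by the factors of the other zeros. *)
Lemma quotient_simple_zeros r rho psi g (s : seq R[i]) : 0 < r < rho ->
  summable_at rho psi -> summable_at rho g -> psi 0%N = 1 -> uniq s ->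
  (forall a, a \in s -> [/\ a != 0, normc a < rho, ev g a = 0 &
     forall chi, summable_at rho chi -> psi = lin a^-1 chi -> ev chi a != 0]) ->
  (forall z, normc z <= r -> ev psi z = 0 -> z \in s) ->
  exists w rho' B, [/\ r < rho' <= rho, cprod w psi = g &
    forall n, normc (w n) * rho' ^+ n <= B].
Proof.
move=> rr; elim: s psi g => [|a s IH] psi g spsi sg psi0 us sP zP.
  apply: quotient_nonvanishing => // z zr.
  by apply/negP => /eqP/(zP z zr); rewrite in_nil.
have rho0 : 0 < rho by case/andP: rr; exact: lt_trans.
move: us; rewrite /= => /andP[as_ us].
have [a0 ar ga simple] := sP a (mem_head _ _).
have sP' b : b \in s -> [/\ b != 0, normc b < rho, ev g b = 0 &
     forall chi, summable_at rho chi -> psi = lin b^-1 chi -> ev chi b != 0].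
  by move=> bs; apply: sP; rewrite inE bs orbT.
have [psia|psia] := eqVneq (ev psi a) 0; last first.
  apply: IH => // z zr /[dup] psiz /(zP z zr); rewrite inE => /orP[/eqP za|//].
  by move: psia; rewrite -za psiz eqxx.
have large : 1 < normc a^-1 * rho.
  by rewrite normcV mulrC ltr_pdivlMr ?mul1r// normc_gt0.
have div u : summable_at rho u -> ev u a = 0 -> summable_at rho (unlin a^-1 u).
  by move=> su ua; apply: unlin_summable_large; rewrite ?invrK.
have evdiv u z : summable_at rho u -> ev u a = 0 -> normc z <= rho ->
    ev u z = (1 - a^-1 * z) * ev (unlin a^-1 u) z.
  by move=> su ua zr; rewrite -(ev_lin _ zr (div u su ua)) unlinK.
have factor_neq0 b : b != a -> 1 - a^-1 * b != 0.
  apply: contra_neq => /eqP; rewrite subr_eq0 eq_sym => /eqP h.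
  by apply: (mulfI (invr_neq0 a0)); rewrite h mulVf.
have [||||w [rho' [B [rr' wpsi wB]]]] :=
    IH (unlin a^-1 psi) (unlin a^-1 g) (div _ spsi psia) (div _ sg ga).
- by [].
- by [].
- move=> b bs; have [b0 br gb bsimple] := sP' b bs.
  have ba : b != a by apply: contraNneq as_ => <-.
  split=> //.
    by apply/eqP; move: gb; rewrite (evdiv g b sg ga (ltW br)) => /eqP;
      rewrite mulf_eq0 (negPf (factor_neq0 b ba)).
  move=> chi schi psiE; apply: contraTneq isT => chib.
  have := bsimple _ (lin_summable a^-1 (ltW rho0) schi).
  rewrite (ev_lin _ (ltW br) schi) chib mulr0 eqxx; apply.
  by rewrite linC -psiE unlinK.
- move=> z zr psiz.
  have zrho : normc z <= rho by case/andP: rr => _ /ltW; exact: le_trans.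
  have : ev psi z = 0 by rewrite evdiv// psiz mulr0.
  move=> /(zP z zr); rewrite inE => /orP[/eqP za|//].
  have := simple _ (div _ spsi psia); rewrite unlinK => /(_ erefl).
  by rewrite -{2}za psiz eqxx.
exists w, rho', B; split=> //.
by rewrite -(unlinK a^-1 psi) cprodC lin_cprod cprodC wpsi unlinK.
Qed.

End Quotient.

(** * Classes of functions of bounded variation *)

Section BVClasses.
Variable R : realType.
Local Notation C := (R[i]^o).
Local Notation I := {i01 R}.
Implicit Types (f g : I -> C) (x y t : I).

(** The class of f when f has bounded variation. It is total, so that proofs of
bounded variation do not occur in terms. *)
Definition cls f : BVhat R := BVclass (insubd (0 : BV R) f).

Lemma bv_predP f : bv f -> f \in @bv_pred R.
Proof. by move=> bf; rewrite unfold_in; apply/asboolP. Qed.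

Lemma clsE (f : BV R) : BVclass f = cls f.
Proof. by rewrite /cls valKd. Qed.

Lemma cls_lin (a : R[i]) f g : bv f -> bv g ->
  cls (a *: f + g) = a *: cls f + cls g.
Proof.
move=> bf bg; rewrite /cls -classZ -classD; congr BVclass; apply/val_inj => /=.
by rewrite !insubdK// ?bv_predP//; apply: bvD => //; exact: bvZ.
Qed.

Lemma clsD f g : bv f -> bv g -> cls (f + g) = cls f + cls g.
Proof. by move=> bf bg; rewrite -[f]scale1r cls_lin// !scale1r. Qed.

Lemma clsZ (a : R[i]) f : bv f -> cls (a *: f) = a *: cls f.
Proof.
move=> bf; rewrite -[in LHS](addr0 (a *: f)) cls_lin//; last exact: bv_cst0.
rewrite [cls 0](_ : _ = 0) ?addr0//; apply/class_eq0.
rewrite unfold_in; apply/asboolP; exists set0 => // x _.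
by rewrite insubdK//; apply: bv_predP; exact: bv_cst0.
Qed.

Lemma cls_eq0 f : bv f ->
  cls f = 0 <-> exists2 A : set I, countable A & forall x, ~ A x -> f x = 0.
Proof.
move=> bf; rewrite /cls class_eq0 unfold_in; split.
  by move=> /asboolP[A cA fA]; exists A => // x /fA; rewrite insubdK// bv_predP.
by move=> [A cA fA]; apply/asboolP; exists A => // x /fA; rewrite insubdK// bv_predP.
Qed.

(** The point 1, which has no preimage, is a null set. *)
Lemma cls_eq f g : bv f -> bv g -> (forall t, t%:num < 1 -> f t = g t) ->
  cls f = cls g.
Proof.
move=> bf bg fg; apply/eqP; rewrite -subr_eq0 addrC -scaleN1r -cls_lin//.
apply/eqP/cls_eq0; first by apply: bvD => //; exact: bvZ.
exists [set to01 1]; first exact: countable1.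
move=> t /= t1; rewrite -[LHS]/(-1 * g t + f t) fg ?mulN1r ?addNr//.
rewrite lt_neqAle num01_le1 andbT; apply/eqP => h; apply: t1.
by apply/val_inj; rewrite [LHS]h; apply/esym/to01K; rewrite ler01 lexx.
Qed.

Lemma PFhat_cls beta (beta_gt1 : 1 < beta) f : bv f ->
  PFhat beta_gt1 (cls f) = cls (PF beta f).
Proof.
move=> bf; rewrite /cls PFhat_class; congr BVclass; apply/val_inj => /=.
by rewrite !insubdK// ?bv_predP//; exact: PF_bv.
Qed.

(** One constant B bounds the modulus of f and the increments of a function V that
controls its variation; such bounds add up. *)
Definition bv_bound f B := exists V : I -> R,
  [/\ forall x y, (x <= y)%O -> normc (f y - f x) <= V y - V x,
      forall x y, V y - V x <= B & forall x, normc (f x) <= B].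

Lemma bv_bound_bv f B : bv_bound f B -> bv f.
Proof. by move=> [V [fV _ _]]; apply/bvP; exists V. Qed.

Lemma bv_boundD f g B B' : bv_bound f B -> bv_bound g B' ->
  bv_bound (f + g) (B + B').
Proof.
move=> [V [fV VB fB]] [W [gW WB gB]]; exists (fun x => V x + W x); split.
- move=> x y xy; rewrite -[(f + g) y]/(f y + g y) -[(f + g) x]/(f x + g x).
  rewrite opprD addrACA (le_trans (le_normcD _ _))//.
  by rewrite opprD addrACA lerD ?fV ?gW.
- by move=> x y; rewrite opprD addrACA lerD.
- by move=> x; rewrite (le_trans (le_normcD _ _))// lerD.
Qed.

Lemma bv_boundZ (a : R[i]) f B : bv_bound f B -> bv_bound (a *: f) (normc a * B).
Proof.
move=> [V [fV VB fB]]; exists (fun x => normc a * V x); split.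
- move=> x y xy; rewrite -[(a *: f) y]/(a * f y) -[(a *: f) x]/(a * f x).
  by rewrite -!mulrBr normcM ler_wpM2l ?normc_ge0 ?fV.
- by move=> x y; rewrite -mulrBr ler_wpM2l ?normc_ge0.
- by move=> x; rewrite -[(a *: f) x]/(a * f x) normcM ler_wpM2l ?normc_ge0.
Qed.

Lemma BV_norm_le (f : BV R) B : bv_bound f B -> BV_norm f <= B + B.
Proof.
move=> [V [fV VB fB]].
have B0 : 0 <= B by have := VB (to01 0) (to01 0); rewrite subrr.
apply: lerD; apply: ge_sup.
- by exists (variation_along f [::]), [::].
- move=> _ [[|x s] /= ss <-]; first by rewrite /variation_along big_nil.
  apply: (@le_trans _ _ (V (last x s) - V x)) => //.
  elim: s x ss => [x _|y s IH x /= /andP[xy ys]].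
    by rewrite variation1 subrr.
  rewrite variation_cons2; apply: (le_trans (lerD (fV _ _ xy) (IH _ ys))).
  by rewrite addrC addrA subrK.
- by exists (normc (f (to01 0))), (to01 0).
- by move=> _ [x _ <-].
Qed.

Lemma BV_norm_ge0 (f : BV R) : 0 <= BV_norm f.
Proof.
have bf : bv f by have := BV_bv f; rewrite unfold_in => /asboolP.
have [B B0 fB] := bv_bounded bf.
apply: addr_ge0.
  apply: ub_le_sup; first exact: bf.
  by exists [::]; rewrite // /variation_along big_nil.
apply: (@le_trans _ _ (normc (f (to01 0)))); first exact: normc_ge0.
by apply: ub_le_sup; [exists B => _ [x _ <-]|exists (to01 0)].
Qed.

Definition cls_bound (F : BVhat R) B := exists2 f, bv_bound f B & F = cls f.

Lemma BVhat_norm_le F B : cls_bound F B -> BVhat_norm F <= B + B.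
Proof.
move=> [f fB ->]; have bf := bv_bound_bv fB.
set g : BV R := insubd 0 f.
have gE : (g : I -> C) = f by rewrite insubdK// bv_predP.
apply: (@le_trans _ _ (BV_norm g)); last by apply: BV_norm_le; rewrite gE.
apply: ge_inf; first by exists 0 => _ [h _ <-]; exact: BV_norm_ge0.
exists (g - BVrep (cls f)); last by rewrite addrC subrK.
by rewrite /= -opprB rpredN class_rep.
Qed.

Lemma cls_boundD F G B B' : cls_bound F B -> cls_bound G B' ->
  cls_bound (F + G) (B + B').
Proof.
move=> [f fB ->] [g gB ->]; exists (f + g); first exact: bv_boundD.
by rewrite clsD//; [exact: bv_bound_bv fB|exact: bv_bound_bv gB].
Qed.

Lemma cls_boundZ a F B : cls_bound F B -> cls_bound (a *: F) (normc a * B).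
Proof.
move=> [f fB ->]; exists (a *: f); first exact: bv_boundZ.
by rewrite clsZ//; exact: bv_bound_bv fB.
Qed.

Lemma cls_bound_sum (n : nat) (F : 'I_n -> BVhat R) (B : 'I_n -> R) :
  (forall i, cls_bound (F i) (B i)) ->
  cls_bound (\sum_(i < n) F i) (\sum_(i < n) B i).
Proof.
move=> FB; apply: (@big_rec2 _ _ (fun F B => cls_bound F B)) => [|i b G _ h].
  exists (fun=> 0).
    by exists (fun=> 0); split => *; rewrite ?subrr ?normc0.
  apply/esym/cls_eq0; first exact: bv_cst0.
  by exists set0.
exact: cls_boundD.
Qed.

Definition ind y : I -> C := fun t => ((t <= y)%O)%:R.

Lemma ind_bound y : bv_bound (ind y) 1.
Proof.
exists (fun t => - ((t <= y)%O)%:R); split.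
- move=> s t st; rewrite /ind; have [ty|ty] := boolP (t <= y)%O.
    by rewrite (le_trans st ty) !subrr normc0.
  case: (s <= y)%O; last by rewrite !subrr normc0.
  by rewrite sub0r normcN normc1 oppr0 opprK add0r.
- move=> s t; case: (t <= y)%O; case: (s <= y)%O;
    by rewrite ?oppr0 ?opprK ?addNr ?add0r ?addr0 ?lerN10 ?ler01 ?lexx.
- by move=> t; rewrite /ind; case: (t <= y)%O; rewrite ?normc1 ?normc0 ?ler01.
Qed.

Lemma ind_bv y : bv (ind y).
Proof. exact: bv_bound_bv (ind_bound y). Qed.

End BVClasses.

(** * The transfer operator on indicators *)

Section BetaDynamics.
Variables (R : realType) (beta : R) (beta_gt1 : 1 < beta).
Local Notation C := (R[i]^o).
Local Notation I := {i01 R}.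
Local Notation T := (tau beta).
Local Notation L := (PFhat beta_gt1).
Implicit Types (x y t : I).

Let beta_gt0 : 0 < beta. Proof. exact: lt_trans beta_gt1. Qed.

Lemma tau_lt1 x : (T x)%:num < 1.
Proof. by rewrite /= ltrBlDl -intrD1 floorD1_gt. Qed.

Lemma digitS n x : digit beta n.+1 x = digit beta 1 (iter n T x).
Proof. by []. Qed.

Lemma digit_tau x : beta * x%:num = (digit beta 1 x)%:~R + (T x)%:num.
Proof. by rewrite /= addrC subrK. Qed.

Lemma digit_nat x : digit beta 1 x = (Num.truncn (beta * x%:num))%:Z.
Proof.
have x0 : 0 <= beta * x%:num by rewrite mulr_ge0// ltW.
by rewrite /digit /= truncn_floor x0 gez0_abs// floor_ge0.
Qed.

Lemma digit_ge0 x : 0 <= (digit beta 1 x)%:~R :> R.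
Proof. by rewrite digit_nat ler0n. Qed.

Lemma digit_le x : (digit beta 1 x)%:~R <= beta.
Proof.
apply: (@le_trans _ _ (beta * x%:num)); first by rewrite digit_tau lerDl.
by rewrite ler_piMr ?num01_le1 ?ltW.
Qed.

Lemma sum_threshold N m (b : bool) : (m < N)%N ->
  \sum_(k < N) ((k < m)%N || (k == m :> nat) && b)%:R = m%:R + b%:R :> C.
Proof.
elim: N => // N IH; rewrite ltnS leq_eqVlt big_ord_recr /= => /orP[/eqP ->|mN].
  rewrite ltnn eqxx /=; congr (_ + _).
  rewrite (eq_bigr (fun=> 1)) ?sumr_const ?card_ord// => k _.
  by rewrite ltn_ord.
by rewrite IH// ltnNge (ltnW mN) gtn_eqF//= addr0.
Qed.

(** The branches before the digit of y lie to the left of y, the branch at the digit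
is cut at the image of y, and the later branches lie to the right of y. *)
Lemma PF_ind y t : t%:num < 1 -> PF beta (ind y) t =
  (beta^-1)%:C * ((digit beta 1 y)%:~R + ind (T y) t).
Proof.
move=> t1; rewrite (PF_branches beta_gt1).
set F := (X in \sum_(k < _) X k).
rewrite -[LHS]/((beta^-1)%:C * (\sum_(k < (Num.truncn beta).+1) F k) t).
congr (_ * _); rewrite fct_sumE {}/F.
pose m := Num.truncn (beta * y%:num).
have mE : beta * y%:num = m%:R + (T y)%:num by rewrite digit_tau digit_nat.
have yb : beta * y%:num <= beta by rewrite ler_piMr ?num01_le1 ?ltW.
have termE k : (if (t%:num < 1) && (t%:num + k%:R <= beta)
      then ind y (to01 ((t%:num + k%:R) / beta)) else 0) =
    ((k < m)%N || (k == m) && (t <= T y)%O)%:R :> C.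
  rewrite t1 /=.
  have -> : (if t%:num + k%:R <= beta then ind y (to01 ((t%:num + k%:R) / beta))
      else 0) = (t%:num + k%:R <= beta * y%:num)%R%:R :> C.
    case: ifPn => [tb|]; last first.
      by rewrite -ltNge => tb; rewrite leNgt (le_lt_trans yb tb).
    rewrite /ind -num_le to01K ?ler_pdivrMr// 1?[_ * beta]mulrC//.
    by rewrite mulr1 tb andbT divr_ge0 ?addr_ge0// ltW.
  congr (nat_of_bool _)%:R; rewrite mE.
  have Ty := tau_lt1 y; have t0 : 0 <= t%:num by [].
  have Ty0 : 0 <= (T y)%:num by [].
  have [km|mk|->] := ltngtP k m.
  - have : k%:R + 1 <= m%:R :> R by rewrite natr1 ler_nat.
    by move=> h; transitivity true => //; lra.
  - have : m%:R + 1 <= k%:R :> R by rewrite natr1 ler_nat.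
    by move=> h; transitivity false => //; apply/negbTE; rewrite -ltNge; lra.
  - by rewrite addrC lerD2l num_le.
have mN : (m < (Num.truncn beta).+1)%N by rewrite ltnS le_truncn.
by rewrite digit_nat -(sum_threshold _ mN); apply: eq_bigr => k _; exact: termE.
Qed.

End BetaDynamics.

Section OrbitTerms.
Variables (R : realType) (beta : R) (beta_gt1 : 1 < beta).
Local Notation C := (R[i]^o).
Local Notation I := {i01 R}.
Local Notation T := (tau beta).
Local Notation L := (PFhat beta_gt1).
Local Notation e := (fun y : {i01 R} => cls (ind y)).
Local Notation one := (to01 1 : {i01 R}).
Implicit Types (x y t : I) (u v w : nat -> C).

Let beta_gt0 : 0 < beta. Proof. exact: lt_trans beta_gt1. Qed.

Lemma ind_one t : ind one t = 1 :> C.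
Proof. by rewrite /ind Defs.lex1. Qed.

Lemma PFhat_ind y : L (e y) =
  (beta^-1)%:C *: ((digit beta 1 y)%:~R *: e one + e (T y)).
Proof.
have bi := @ind_bv R; rewrite PFhat_cls// -cls_lin// -clsZ; last first.
  by apply: bvD => //; exact: bvZ.
apply: cls_eq; [exact: PF_bv|by apply: bvZ; apply: bvD => //; exact: bvZ|].
move=> t t1; rewrite PF_ind//.
rewrite -[RHS]/((beta^-1)%:C * ((digit beta 1 y)%:~R * ind one t + ind (T y) t)).
by rewrite ind_one mulr1.
Qed.

(** As a power series at 1 / lambda, this is the function F_lambda of the theorem. *)
Definition digit_series y n : C :=
  if n is k.+1 then (digit beta k.+1 y)%:~R / beta%:C ^+ k.+1 else 0.

(** The reciprocal of a zero in the disc of radius beta is an eigenvalue. *)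
Definition char_series n : C := unit_series R[i] n - digit_series one n.

(** Normalized so that the operator moves one term to the next, up to a multiple of
the class of 1. *)
Definition orbit_term y n : BVhat R := (beta%:C ^- n) *: e (iter n T y).

Lemma PFhat_orbit_term y n : L (orbit_term y n) = digit_series y n.+1 *: e one + orbit_term y n.+1.
Proof.
rewrite /orbit_term linearZ /= PFhat_ind -digitS !scalerDr !scalerA /=.
have -> : beta%:C ^- n * (beta^-1)%:C = beta%:C ^- n.+1 :> R[i].
  by rewrite exprSr invfM fmorphV.
by rewrite [_ * (digit _ _ _)%:~R]mulrC.
Qed.

Lemma orbit_term0 y : orbit_term y 0 = e y.
Proof. by rewrite /orbit_term expr0 invr1 scale1r. Qed.

Lemma orbit_term_bound y n : cls_bound (orbit_term y n) (beta ^- n).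
Proof.
have -> : beta ^- n = normc (beta%:C ^- n : R[i]) * 1.
  by rewrite mulr1 normcV normcX normc_real gtr0_norm.
by apply: cls_boundZ; exists (ind (iter n T y)) => //; exact: ind_bound.
Qed.

(** Applying L once more, the terms contribute to the class of 1 the coefficient of
degree n + 1 of g + w F_1, where g is the sum of the c_i F_(x_i). It is w_(n+1)
since w F_1 = w - w psi = w - g. *)
Lemma iter_PFhat (m : nat) (c : 'I_m -> R[i]) (x : 'I_m -> I) w n :
  cprod w char_series = (fun k => \sum_i c i * digit_series (x i) k) ->
  iter n L (\sum_i c i *: e (x i)) =
  \sum_i c i *: orbit_term (x i) n + \sum_(k < n.+1) w k *: orbit_term one (n - k).
Proof.
move=> wpsi.
have w0 : w 0%N = 0.
  have := congr1 (fun f => f 0%N) wpsi; rewrite /cprod big_ord1 /char_series /=.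
  by rewrite subr0 mulr1 big1 // => i _; rewrite mulr0.
have wS k : w k.+1 = \sum_i c i * digit_series (x i) k.+1 +
    \sum_(j < k.+1) w j * digit_series one (k - j).+1.
  rewrite -[X in X + _](congr1 (fun f => f k.+1) wpsi) /cprod big_ord_recr /=.
  rewrite subnn /char_series /= subr0 mulr1 addrAC -big_split /= big1 ?add0r// => j _.
  have jk : (j <= k)%N by rewrite -ltnS.
  by rewrite subSn// /unit_series /= sub0r mulrN addNr.
elim: n => [|n IH].
  rewrite /= big_ord1 w0 scale0r addr0; apply: eq_bigr => i _.
  by rewrite orbit_term0.
rewrite iterS IH linearD !linear_sum /= [in RHS]big_ord_recr /= subnn orbit_term0 wS.
have -> : \sum_(i < m) L (c i *: orbit_term (x i) n) =
    (\sum_i c i * digit_series (x i) n.+1) *: e one + \sum_i c i *: orbit_term (x i) n.+1.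
  rewrite scaler_suml -big_split; apply: eq_bigr => i _ /=.
  by rewrite linearZ /= PFhat_orbit_term scalerDr scalerA.
have -> : \sum_(k < n.+1) L (w k *: orbit_term one (n - k)) =
    (\sum_(k < n.+1) w k * digit_series one (n - k).+1) *: e one +
    \sum_(k < n.+1) w k *: orbit_term one (n.+1 - k).
  rewrite scaler_suml -big_split; apply: eq_bigr => k _ /=.
  by rewrite linearZ /= PFhat_orbit_term scalerDr scalerA subSn// -ltnS.
by rewrite scalerDl addrACA [RHS]addrA [RHS]addrC.
Qed.

Lemma cls_sum (m : nat) (F : 'I_m -> I -> C) : (forall i, bv (F i)) ->
  cls (\sum_(i < m) F i) = \sum_(i < m) cls (F i).
Proof.
move=> bF; elim: m F bF => [|m IH] F bF.
  rewrite !big_ord0; apply/cls_eq0; first exact: bv_cst0.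
  by exists set0.
by rewrite !big_ord_recr /= clsD ?IH//; apply: bv_sum.
Qed.

Lemma step_cls (m : nat) (c : 'I_m -> R[i]) (x : 'I_m -> I) :
  BVclass (step_BV c x) = \sum_i c i *: e (x i).
Proof.
rewrite clsE (_ : (step_BV c x : I -> C) = \sum_i c i *: ind (x i)).
  rewrite cls_sum => [|i]; last by apply: bvZ; exact: ind_bv.
  by apply: eq_bigr => i _; rewrite clsZ//; exact: ind_bv.
apply/funext => t; rewrite fct_sumE /= /step; apply: eq_bigr => i _.
rewrite -[RHS]/(c i * ind (x i) t) indicE /ind -num_le; congr (_ * (nat_of_bool _)%:R).
apply/idP/idP => [/set_mem/= /andP[]//|tx].
by apply: mem_set => /=; rewrite tx num01_ge0.
Qed.

End OrbitTerms.

(** * Infinite combinations along the orbit of 1 *)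

Section OrbitSums.
Variables (R : realType) (beta : R) (beta_gt1 : 1 < beta).
Local Notation C := (R[i]^o).
Local Notation I := {i01 R}.
Local Notation T := (tau beta).
Local Notation L := (PFhat beta_gt1).
Local Notation one := (to01 1 : {i01 R}).
Local Notation y_ n := (iter n T one).
Implicit Types (x y t : I) (u v w : nat -> C).

Let beta_gt0 : 0 < beta. Proof. exact: lt_trans beta_gt1. Qed.

Definition orbit_sum v t : C := ev (fun n => v n * ind (y_ n) t) 1.

Lemma normc_ind y t : normc (ind y t) <= 1.
Proof. by rewrite /ind; case: (t <= y)%O; rewrite ?normc1 ?normc0 ?ler01. Qed.

Lemma summable_ind v y t : summable_at 1 v ->
  summable_at 1 (fun n => v n * ind (iter n T y) t).
Proof. by move=> sv; apply: summable_mul_bounded sv _ => // n; exact: normc_ind. Qed.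

Lemma orbit_sum_cvg v t : summable_at 1 v ->
  series (fun n => v n * ind (y_ n) t) @ \oo --> orbit_sum v t.
Proof. by move=> sv; apply: ev1_cvg; exact: summable_ind. Qed.

(** The increments are controlled by those of the sum of the moduli. *)
Lemma orbit_sum_bv v : summable_at 1 v -> bv (orbit_sum v).
Proof.
move=> sv; have [B vB] := (summable1P v).1 sv.
pose w t n := normc (v n) * ((t <= y_ n)%O)%:R.
have w0 t n : 0 <= w t n by rewrite mulr_ge0 ?normc_ge0.
have cw t : cvgn (series (w t)).
  apply: (@bounded_series_cvg _ _ B) => // m; apply: le_trans (vB m).
  rewrite !seriesEnat /=; apply: ler_sum => i _.
  by rewrite ler_piMr ?normc_ge0// lern1 leq_b1.
apply/bvP; exists (fun t => - limn (series (w t))) => s t st.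
rewrite opprK [leRHS]addrC.
have hst : (fun m => normc (series (fun n => v n * ind (y_ n) t) m -
    series (fun n => v n * ind (y_ n) s) m)) @ \oo --> normc (orbit_sum v t - orbit_sum v s).
  apply: cvg_normc.
  have h1 := cvgcZ (a := -1) (orbit_sum_cvg (t := s) sv).
  have := cvgcD (orbit_sum_cvg (t := t) sv) h1.
  by rewrite mulN1r; under eq_fun do rewrite mulN1r.
have ws : (fun m => series (w s) m - series (w t) m) @ \oo -->
    limn (series (w s)) - limn (series (w t)).
  by apply: cvgB; exact: cw.
apply: ler_cvg_to hst ws _; apply: nearW => m.
rewrite !seriesEnat /= -!sumrB.
apply: le_trans (normc_sum _ _ _) _; apply: ler_sum => n _.
rewrite -mulrBr normcM /w -mulrBr ler_wpM2l ?normc_ge0// /ind.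
have [ty|ty] := boolP (t <= y_ n)%O.
  by rewrite (le_trans st ty) !subrr normc0.
case: (s <= y_ n)%O; last by rewrite !subrr normc0.
by rewrite sub0r normcN normc1 subr0.
Qed.

Lemma orbit_sum_lin a u v : summable_at 1 u -> summable_at 1 v ->
  orbit_sum (fun n => a * u n + v n) = a *: orbit_sum u + orbit_sum v.
Proof.
move=> su sv; apply/funext => t; apply: ev_unique.
have := cvgcD (cvgcZ (a := a) (orbit_sum_cvg (t := t) su)) (orbit_sum_cvg (t := t) sv).
set f := fun n => _ + _.
suff -> : series (fun n => (a * u n + v n) * ind (y_ n) t * 1 ^+ n) = f by [].
apply/funext; rewrite /f; elim=> [|n IH]; first by rewrite !series0 mulr0 addr0.
rewrite [LHS]seriesS_sum IH !seriesS_sum expr1n; ring.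
Qed.

Lemma orbit_sumZ a v : summable_at 1 v -> orbit_sum (fun n => a * v n) = a *: orbit_sum v.
Proof.
move=> sv; apply/funext => t; apply: ev_unique.
have := cvgcZ (a := a) (orbit_sum_cvg (t := t) sv); set f := fun n => _.
suff -> : series (fun n => a * v n * ind (y_ n) t * 1 ^+ n) = f by [].
apply/funext; rewrite /f; elim=> [|n IH]; first by rewrite !series0 mulr0.
by rewrite [LHS]seriesS_sum IH seriesS_sum expr1n mulr1 mulrDr -mulrA.
Qed.

(** The coefficients of beta times the image of an orbit sum: the points move one
step along the orbit, and the full branches contribute multiples of the constant
1, which is the indicator at the orbit point of index 0. *)
Definition orbit_shift v n : C :=
  if n is k.+1 then v k
  else ev (fun n => v n * (digit beta n.+1 one)%:~R) 1.

Lemma PF_branch_sum g t : PF beta g t = (beta^-1)%:C *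
  \sum_(k < (Num.truncn beta).+1)
    if (t%:num < 1) && (t%:num + k%:R <= beta)
    then g (to01 ((t%:num + k%:R) / beta)) else 0.
Proof.
rewrite (PF_branches beta_gt1); set F := (X in \sum_(k < _) X k).
rewrite -[LHS]/((beta^-1)%:C * (\sum_(k < (Num.truncn beta).+1) F k) t).
by rewrite fct_sumE.
Qed.

(** The operator is a finite sum over branches. *)
Lemma PF_cvg (f_ : nat -> I -> C) f :
  (forall t, (fun n => f_ n t) @ \oo --> f t) ->
  forall t, (fun n => PF beta (f_ n) t) @ \oo --> PF beta f t.
Proof.
move=> ff t.
rewrite PF_branch_sum; under eq_fun do rewrite PF_branch_sum.
apply: cvgcZ; apply: cvgc_sum => k; case: ifP => // _.
exact: cvgc_cst.
Qed.

Lemma summable_digit v : summable_at 1 v ->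
  summable_at 1 (fun n => v n * (digit beta n.+1 one)%:~R).
Proof.
move=> sv; apply: (summable_mul_bounded (D := beta)) sv _ => // n.
rewrite digitS.
have -> : (digit beta 1 (y_ n))%:~R = ((digit beta 1 (y_ n))%:~R)%:C :> R[i].
  by rewrite rmorph_int.
by rewrite normc_real ger0_norm ?digit_ge0 ?digit_le.
Qed.

Lemma PF_orbit_sum v t : summable_at 1 v -> summable_at 1 (orbit_shift v) -> t%:num < 1 ->
  PF beta (orbit_sum v) t = (beta^-1)%:C * orbit_sum (orbit_shift v) t.
Proof.
move=> sv ssv t1.
pose f m s := series (fun n => v n * ind (y_ n) s) m.
have fS m : f m.+1 = v m *: ind (y_ m) + f m.
  by apply/funext => s; rewrite /f seriesS_sum addrC.
have h1 : (fun n => PF beta (f n) t) @ \oo --> PF beta (orbit_sum v) t.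
  by apply: PF_cvg => s; exact: orbit_sum_cvg.
have h2 := ev1_cvg (summable_digit sv).
have h3 := ev1_cvg (summable_ind (T one) t sv).
have PFf m : PF beta (f m) t = (beta^-1)%:C *
    (series (fun n => v n * (digit beta n.+1 one)%:~R) m +
     series (fun n => v n * ind (iter n T (T one)) t) m).
  elim: m => [|m IH].
    have -> : f 0%N = 0 by apply/funext => s; rewrite /f series0.
    rewrite !series0 addr0 mulr0.
    by rewrite -[0 : I -> C](subrr 0) -scaleN1r addrC (PF_scaleD beta_gt1)
      scaleN1r addNr.
  rewrite fS (PF_scaleD beta_gt1).
  rewrite -[LHS]/(v m * PF beta (ind (y_ m)) t + PF beta (f m) t) IH PF_ind//.
  rewrite !seriesS_sum digitS -iterSr iterS; ring.
rewrite (funext PFf) in h1.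
have h4 := cvgcZ (a := (beta^-1)%:C) (cvgcD h2 h3).
rewrite (cvgc_unique h1 h4); congr (_ * _).
have h5 := cvgcD (@cvgc_cst R (orbit_shift v 0%N)) h3.
apply: (cvgc_unique h5).
have := cvgc_shift (orbit_sum_cvg (t := t) ssv).
set g := fun n => _; set g' := fun n => _; suff -> : g = g' by [].
apply/funext => n; rewrite /g /g'; elim: n => [|n IH].
  by rewrite seriesS_sum !series0 add0r addr0 ind_one mulr1.
by rewrite seriesS_sum IH [in RHS]seriesS_sum addrA -iterSr.
Qed.

End OrbitSums.

Section Eigenvectors.
Variables (R : realType) (beta : R) (beta_gt1 : 1 < beta).
Local Notation C := (R[i]^o).
Local Notation I := {i01 R}.
Local Notation T := (tau beta).
Local Notation L := (PFhat beta_gt1).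
Local Notation one := (to01 1 : {i01 R}).
Local Notation y_ n := (iter n T one).
Implicit Types (x y t : I) (u v w : nat -> C) (a : C) (rho : R).

Let beta_gt0 : 0 < beta. Proof. exact: lt_trans beta_gt1. Qed.

Let betaC_neq0 : beta%:C != 0 :> R[i].
Proof. by rewrite -normc_gt0 normc_real gtr0_norm. Qed.

Lemma digit_series_term y n : normc (digit_series beta y n) * beta ^+ n <= beta.
Proof.
case: n => [|n]; first by rewrite normc0 mul0r ltW.
rewrite /digit_series digitS normcM normcV normcX normc_real gtr0_norm// -mulrA mulVf ?mulr1; last first.
  by rewrite expf_neq0// gt_eqF.
have -> : (digit beta 1 (iter n T y))%:~R = ((digit beta 1 (iter n T y))%:~R)%:C :> R[i].
  by rewrite rmorph_int.
by rewrite normc_real ger0_norm ?digit_ge0 ?digit_le.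
Qed.

Lemma digit_series_summable y rho : 0 <= rho < beta -> summable_at rho (digit_series beta y).
Proof. by move=> rb; exact: summable_geo rb (digit_series_term y). Qed.

Lemma PFhat_orbit_sum v : summable_at 1 v -> summable_at 1 (orbit_shift beta v) ->
  L (cls (orbit_sum beta v)) = (beta^-1)%:C *: cls (orbit_sum beta (orbit_shift beta v)).
Proof.
move=> sv ssv; rewrite PFhat_cls; last exact: orbit_sum_bv.
rewrite -clsZ; last exact: orbit_sum_bv.
apply: cls_eq => [||t t1]; [exact/PF_bv/orbit_sum_bv|exact/bvZ/orbit_sum_bv|].
by rewrite PF_orbit_sum.
Qed.

Section ShiftEigenvectors.
Variable a : C.
Hypotheses (a0 : a != 0) (ab : normc a < beta).
Hypothesis phi1 : ev (digit_series beta one) a = 1.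
Let q : C := a / beta%:C.
Let v n : C := q ^+ n.
Let v' n : C := n.+1%:R * q ^+ n.

Let q0 : q != 0. Proof. by rewrite mulf_neq0// invr_eq0. Qed.

Let q1 : normc q < 1.
Proof.
by rewrite normcM normcV normc_real gtr0_norm// ltr_pdivrMr// mul1r.
Qed.

Let sv : summable_at 1 v. Proof. by case: (geo_weight_summable q1). Qed.
Let sv' : summable_at 1 v'. Proof. by case: (geo_weight_summable q1). Qed.

Let phiq n : digit_series beta one n.+1 * a ^+ n.+1 = q * (q ^+ n * (digit beta n.+1 one)%:~R).
Proof.
by rewrite /digit_series mulrA -exprS /q expr_div_n mulrC mulrA mulrAC.
Qed.

(** The coefficient of index 0 is F_1(a) / q = 1 / q. *)
Lemma orbit_shift_eigen : orbit_shift beta v = (fun n => q^-1 * v n).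
Proof.
apply/funext => -[|n] /=; last by rewrite /v exprS mulrA mulVf// mul1r.
rewrite /v expr0 mulr1; apply: cvgc_unique (ev1_cvg (summable_digit beta_gt1 sv)) _.
have sphi : summable_at (normc a) (digit_series beta one).
  by apply: digit_series_summable; rewrite normc_ge0.
have := cvgcZ (a := q^-1) (cvgc_shift (ev_cvg (lexx _) sphi)).
rewrite phi1 mulr1; set f := fun n => _.
suff -> : series (fun n => v n * (digit beta n.+1 one)%:~R) = f by [].
apply/funext => n; rewrite /f; elim: n => [|n IH].
  by rewrite seriesS_sum !series0 /digit_series mul0r addr0 mulr0.
by rewrite [in RHS]seriesS_sum seriesS_sum mulrDr -IH phiq mulKf.
Qed.

Hypothesis dphi : series (fun n => n%:R * digit_series beta one n * a ^+ n) @ \oo --> (0 : C).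

(** The coefficient of index 0 is the derivative of F_1 at a, up to a factor, hence
zero. *)
Lemma orbit_shift_generalized : orbit_shift beta v' = (fun n => q^-1 * (v' n - v n)).
Proof.
apply/funext => -[|n] /=; last first.
  rewrite /v' /v -[n.+2%:R]natr1 mulrDl mul1r addrK exprS [n.+1%:R * (q * _)]mulrCA.
  by rewrite mulKf.
rewrite /v' /v expr0 mulr1 subrr mulr0.
apply: cvgc_unique (ev1_cvg (summable_digit beta_gt1 sv')) _.
have := cvgcZ (a := q^-1) (cvgc_shift dphi).
rewrite mulr0; set f := fun n => _.
suff -> : series (fun n => v' n * (digit beta n.+1 one)%:~R) = f by [].
apply/funext => n; rewrite /f; elim: n => [|n IH].
  by rewrite seriesS_sum !series0 !mul0r addr0 mulr0.
rewrite [in RHS]seriesS_sum seriesS_sum mulrDr -IH -mulrA phiq; congr (_ + _).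
by rewrite mulrCA mulKf// /v' mulrA.
Qed.

End ShiftEigenvectors.

End Eigenvectors.

(** * Zeros of the characteristic series and eigenvalues *)

Section EigenvectorClasses.
Variables (R : realType) (beta : R) (beta_gt1 : 1 < beta).
Local Notation C := (R[i]^o).
Local Notation I := {i01 R}.
Local Notation T := (tau beta).
Local Notation L := (PFhat beta_gt1).
Local Notation one := (to01 1 : {i01 R}).
Local Notation y_ n := (iter n T one).
Implicit Types (x y t : I) (u v w : nat -> C) (a : C) (rho : R).

Let beta_gt0 : 0 < beta. Proof. exact: lt_trans beta_gt1. Qed.

Let betaC_neq0 : beta%:C != 0 :> R[i].
Proof. by rewrite -normc_gt0 normc_real gtr0_norm. Qed.

Lemma orbit_lt m : exists2 y : R, 0 <= y < 1 &
  forall n, (1 <= n < m)%N -> (y_ n)%:num <= y.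
Proof.
elim: m => [|m [y /andP[y0 y1] IH]].
  by exists 0; [rewrite lexx ltr01|move=> n; rewrite ltn0 andbF].
case: m IH => [|m] IH.
  by exists y; [rewrite y0|case].
exists (Num.max y (y_ m.+1)%:num).
  by rewrite le_max y0 /= gt_max y1 /= tau_lt1.
move=> n /andP[n0]; rewrite ltnS leq_eqVlt => /orP[/eqP ->|nm].
  by rewrite le_max lexx orbT.
by rewrite le_max IH ?n0.
Qed.

(** A countable set has measure zero. *)
Lemma uncountable_right (A : set I) (y : R) : 0 <= y < 1 ->
  (forall t : I, y < t%:num -> A t) -> ~ countable A.
Proof.
move=> /andP[y0 y1] yA cA.
have : countable `]y, 1[%classic.
  apply: (@sub_countable _ _ _ ((fun t : I => t%:num) @` A)).
    apply: subset_card_le => r /=; rewrite in_itv /= => /andP[yr r1].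
    have rE : (to01 r)%:num = r by rewrite to01K// (le_trans y0 (ltW yr)) ltW.
    by exists (to01 r) => //; apply: yA; rewrite rE.
  exact: sub_countable (card_image_le _ _) cA.
move=> /countable_lebesgue_measure0; rewrite lebesgue_measure_itv /= lte_fin y1.
by move=> /eqP; rewrite -EFinB eqe subr_eq0 gt_eqF.
Qed.

(** The other points of the orbit of 1 lie below 1 and the tail is small, so that
just below 1 the sum is close to its term of index 0. *)
Lemma orbit_sum_neq0 v : summable_at 1 v -> v 0%N != 0 -> cls (orbit_sum beta v) != 0.
Proof.
move=> sv v0; apply/eqP => /(cls_eq0 (orbit_sum_bv beta sv)) [A cA hA].
have [B vB] := (summable1P v).1 sv.
have nv0 : 0 < normc (v 0%N) by rewrite normc_gt0.
have e0 : 0 < normc (v 0%N) / 2 by rewrite divr_gt0.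
have [m0 tail] := bounded_series_tail (fun n => normc_ge0 (v n)) vB e0.
have [y y01 yP] := orbit_lt m0.+1.
apply: (uncountable_right y01 _ cA) => t yt; apply: contrapT => /hA ht.
have : normc (orbit_sum beta v t - v 0%N) <= normc (v 0%N) / 2.
  apply: (cvg_normc_le (orbit_sum_cvg (t := t) sv)); near=> k.
  have mk : (m0.+1 <= k)%N by near: k; exact: nbhs_infty_ge.
  rewrite seriesEnat /= big_ltn ?(leq_ltn_trans _ mk)// ind_one mulr1 addrC addKr.
  rewrite (big_cat_nat (_ : 1 <= m0.+1)%N mk)//= big_nat big1 ?add0r => [|i im]; last first.
    by rewrite /ind -num_le leNgt (le_lt_trans (yP i im) yt) mulr0.
  apply: le_trans (normc_sum _ _ _) _.
  apply: le_trans (tail m0.+1 k _); last by rewrite leqnSn mk.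
  by apply: ler_sum => i _; rewrite normcM ler_piMr ?normc_ge0 ?normc_ind.
rewrite ht sub0r normcN; lra.
Unshelve. all: by end_near. Qed.

Section AtZero.
Variable a : C.
Hypotheses (a0 : a != 0) (ab : normc a < beta).
Hypothesis phi1 : ev (digit_series beta one) a = 1.
Let q : C := a / beta%:C.
Let h := cls (orbit_sum beta (fun n => q ^+ n)).
Let h' := cls (orbit_sum beta (fun n => n.+1%:R * q ^+ n)).

Let q1 : normc q < 1.
Proof.
by rewrite normcM normcV normc_real gtr0_norm// ltr_pdivrMr// mul1r.
Qed.

Let qV : (beta^-1)%:C * q^-1 = a^-1.
Proof. by rewrite fmorphV /q invfM invrK mulrCA mulVf ?mulr1. Qed.

Let h_neq0 : h != 0.
Proof.
apply: orbit_sum_neq0; last by rewrite expr0 oner_eq0.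
by case: (geo_weight_summable q1).
Qed.

Let L_h : L h = a^-1 *: h.
Proof.
have [sv _] := geo_weight_summable q1.
rewrite PFhat_orbit_sum//; last by rewrite orbit_shift_eigen//; exact: summable_atZ.
rewrite orbit_shift_eigen// orbit_sumZ// clsZ; last exact: orbit_sum_bv.
by rewrite scalerA qV.
Qed.

Lemma root_eigenvalue : PF_eigenvalue beta_gt1 a^-1.
Proof. by exists h; [exact: h_neq0|exact: L_h]. Qed.

(** With h the eigenvector and h' the orbit sum with coefficients (n + 1) q^n, one
has (1/a - L) h' = h / a. In a line the operator acts by a scalar, so that h and
h' cannot both belong to one. *)
Lemma double_root_not_simple :
  series (fun n => n%:R * digit_series beta one n * a ^+ n) @ \oo --> (0 : C) ->
  ~ simple_eigenvalue beta_gt1 a^-1.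
Proof.
move=> dphi [e [_ eE]].
have [sv sv'] := geo_weight_summable q1.
have sd : summable_at 1 (fun n => n.+1%:R * q ^+ n - q ^+ n).
  rewrite (_ : (fun n => _) = (fun n => n.+1%:R * q ^+ n + -1 * q ^+ n)).
    by apply: summable_atD => //; exact: summable_atZ.
  by apply/funext => n; rewrite mulN1r.
have L_h' : L h' = a^-1 *: (h' - h).
  rewrite PFhat_orbit_sum//; last first.
    by rewrite orbit_shift_generalized//; exact: summable_atZ.
  rewrite orbit_shift_generalized// orbit_sumZ// clsZ; last exact: orbit_sum_bv.
  rewrite scalerA qV; congr (_ *: _).
  rewrite (_ : (fun n => _) = (fun n => -1 * q ^+ n + n.+1%:R * q ^+ n)); last first.
    by apply/funext => n; rewrite mulN1r addrC.
  rewrite orbit_sum_lin// cls_lin ?scaleN1r 1?addrC//; exact: orbit_sum_bv.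
have step G : iter 1 (fun G => a^-1 *: G - L G) G = a^-1 *: G - L G by [].
have Dh : a^-1 *: h - L h = 0 by rewrite L_h subrr.
have Dh' : a^-1 *: h' - L h' = a^-1 *: h.
  by rewrite L_h' scalerBr opprB addrCA subrr addr0.
have : gen_eigenspace beta_gt1 a^-1 h by exists 1%N.
have : gen_eigenspace beta_gt1 a^-1 h'.
  by exists 2%N => //=; rewrite Dh' [X in _ - X]linearZ -scalerBr Dh scaler0.
rewrite eE => -[s' _ h'E] [s _ hE].
move: h'E hE; rewrite !big_ord1 => h'E hE.
have s0 : s ord0 != 0 by apply: contraNneq h_neq0 => s0; rewrite -hE s0 scale0r.
(* Both generalized eigenvectors are multiples of the basis vector. *)
have h'h : h' = (s' ord0 / s ord0) *: h.
  by rewrite -h'E -hE scalerA -mulrA mulVf ?mulr1.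
have : a^-1 *: h = 0.
  rewrite -Dh' h'h; set k := s' ord0 / s ord0.
  rewrite [X in _ - X]linearZ /= scalerA [a^-1 * k]mulrC -scalerA -scalerBr.
  by rewrite Dh scaler0.
by move/eqP; rewrite scaler_eq0 invr_eq0 (negPf a0) (negPf h_neq0).
Qed.

End AtZero.

End EigenvectorClasses.

(** * Size of the eigenvalues and decay of correlations *)

Section Decay.
Variables (R : realType) (beta : R) (beta_gt1 : 1 < beta).
Local Notation C := (R[i]^o).
Local Notation I := {i01 R}.
Local Notation T := (tau beta).
Local Notation L := (PFhat beta_gt1).
Local Notation one := (to01 1 : {i01 R}).
Local Notation y_ n := (iter n T one).
Implicit Types (x y t : I) (u v w : nat -> C) (a : C) (rho : R).

Let beta_gt0 : 0 < beta. Proof. exact: lt_trans beta_gt1. Qed.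

(** On the fibres that avoid A, the function may be replaced by 0 on A. *)
Lemma PF_bound (f : I -> C) (A : set I) b : 0 <= b ->
  (forall y, ~ A y -> normc (f y) <= b) -> forall x, ~ (T @` A) x ->
  normc (PF beta f x) <= beta^-1 * (Num.truncn beta).+1%:R * b.
Proof.
move=> b0 fA x xA; pose f' : I -> C := fun y => if `[< A y >] then 0 else f y.
have f'b y : normc (f' y) <= b.
  rewrite /f'; case: asboolP => [_|/fA//]; by rewrite normc0.
have -> : PF beta f x = PF beta f' x.
  have -> : f = 1 *: (f - f') + f' by rewrite scale1r subrK.
  rewrite (PF_scaleD beta_gt1) scale1r.
  rewrite -[LHS]/(PF beta (f - f') x + PF beta f' x).
  rewrite (@PF_vanish _ beta (f - f') A) ?add0r// => y yA.
  rewrite -[LHS]/(f y - f' y) /f'; case: asboolP => // _; exact: subrr.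
rewrite PF_branch_sum// normcM normc_real gtr0_norm ?invr_gt0// -mulrA.
apply: ler_wpM2l; first by rewrite invr_ge0 ltW.
apply: le_trans (normc_sum _ _ _) _.
rewrite mulr_natl -[X in _ *+ X]card_ord -sumr_const; apply: ler_sum => k _.
by case: ifP => // _; rewrite normc0.
Qed.

(** If lam were larger, then the eigenfunction equation would improve a bound
valid off a countable set by a constant factor. Iterating, the eigenfunction would
vanish off a countable set. *)
Lemma eigenvalue_bound lam : PF_eigenvalue beta_gt1 lam ->
  normc lam <= beta^-1 * (Num.truncn beta).+1%:R.
Proof.
move=> [F F0 LF]; rewrite leNgt; apply/negP => kl.
set k := beta^-1 * (Num.truncn beta).+1%:R in kl.
have k0 : 0 <= k by rewrite mulr_ge0// invr_ge0 ltW.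
have l0 : 0 < normc lam by exact: le_lt_trans kl.
pose f : I -> C := BVrep F.
have bf : bv f by have := BV_bv (BVrep F); rewrite unfold_in => /asboolP.
have FE : F = cls f by rewrite -clsE repK.
have bPF : bv (PF beta f) by exact: PF_bv.
have : cls (- lam *: f + PF beta f) = 0.
  by rewrite cls_lin// -PFhat_cls// -FE LF scaleNr addNr.
move=> /cls_eq0 => /(_ (bvD (bvZ _ bf) bPF)) [A0 cA0 fA0].
have [b0 b00 fb0] := bv_bounded bf.
have q0 : 0 <= k / normc lam by rewrite divr_ge0 ?normc_ge0.
have q1 : k / normc lam < 1 by rewrite ltr_pdivrMr// mul1r.
set q := k / normc lam in q0 q1.
(* Each step discards the exceptional set of the eigenfunction equation and
   the forward image of the previous exceptional set. *)
have improve n : exists2 A : set I, countable A &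
    forall x, ~ A x -> normc (f x) <= q ^+ n * b0.
  elim: n => [|n [A cA fA]].
    by exists set0 => // x _; rewrite expr0 mul1r.
  exists (A0 `|` T @` A).
    rewrite -bigcup2E; apply: bigcup_countable => // -[|[|i]] _ //=.
    exact: sub_countable (card_image_le _ _) cA.
  move=> x /not_orP[xA0 xA].
  have PFx : PF beta f x = lam * f x.
    have := fA0 _ xA0; rewrite -[X in X = 0 -> _]/(- lam * f x + PF beta f x).
    by move=> /eqP; rewrite addrC mulNr subr_eq0 => /eqP.
  have b1 : 0 <= q ^+ n * b0 by rewrite mulr_ge0 ?exprn_ge0.
  have := PF_bound b1 fA xA; rewrite PFx normcM -/k mulrC -ler_pdivlMr//.
  by move=> /le_trans; apply; rewrite exprS mulrAC /q !mulrA mulrAC.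
have [A AP] := choice (fun n => let: ex_intro2 A cA fA := improve n in
  ex_intro (fun A => countable A /\ _) A (conj cA fA)).
apply/negP: F0; rewrite negbK FE; apply/eqP/(cls_eq0 bf).
exists (\bigcup_n A n).
  by apply: bigcup_countable => // n _; exact: (AP n).1.
move=> x xA; apply/eq0_normc/eqP; rewrite eq_le normc_ge0 andbT.
have qc : (fun n => b0 * q ^+ n) @ \oo --> (0 : R).
  by apply: cvg_geometric; rewrite ger0_norm.
apply: (ler_cvg_to (cvg_cst (normc (f x))) qc); apply: nearW => n.
by rewrite mulrC; apply: (AP n).2 => An; apply: xA; exists n.
Qed.

Lemma nonleading_ubound :
  has_ubound [set normc lam | lam in [set lam | nonleading beta_gt1 lam]].
Proof.
by exists (beta^-1 * (Num.truncn beta).+1%:R) => _ [lam [+ _ _] <-];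
  exact: eigenvalue_bound.
Qed.

Lemma subleading_modulus_ge lam : nonleading beta_gt1 lam ->
  normc lam <= subleading_modulus beta_gt1.
Proof. by move=> h; apply: (ub_le_sup nonleading_ubound); exists lam. Qed.

(** This is the expansion of y in base beta. *)
Lemma ev_digit_series1 y : ev (digit_series beta y) 1 = (y%:num)%:C.
Proof.
apply: ev_unique; apply: cvgc_unshift.
have partial n : series (fun n => digit_series beta y n * 1 ^+ n) n.+1 =
    (y%:num - (iter n T y)%:num / beta ^+ n)%:C.
  elim: n => [|n IH].
    by rewrite seriesS_sum series0 mul0r addr0 expr0 divr1 subrr.
  rewrite seriesS_sum IH expr1n mulr1 /digit_series digitS.
  have e : (iter n T y)%:num = ((digit beta 1 (iter n T y))%:~R + (iter n.+1 T y)%:num) / beta.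
    by rewrite iterS -digit_tau mulrAC divff ?mul1r// gt_eqF.
  rewrite [in LHS]e -rmorphXn -(rmorph_int (real_complex R)) -fmorphV -rmorphM -rmorphD /=.
  congr (_ %:C); rewrite exprS invfM; ring.
apply/cvgcP => e e0.
have gc : (fun n => 1 * beta^-1 ^+ n) @ \oo --> (0 : R).
  by apply: cvg_geometric; rewrite ger0_norm ?invr_ge0 ?ltW// invf_lt1.
move/cvgrPdist_lt : gc => /(_ _ e0); apply: filterS => n.
rewrite sub0r normrN mul1r partial; apply: le_lt_trans.
rewrite -rmorphB opprB addrC subrK normc_real exprVn normrM normfV.
by rewrite ler_piMl// ger0_norm.
Qed.

Lemma F_seriesE lam y : F_series beta lam y = ev (digit_series beta y) lam^-1.
Proof.
rewrite ev.unlock /F_series; congr (limn _); apply/funext => m.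
rewrite seriesEnat /=; case: m => [|m]; first by rewrite !big_geq.
rewrite [RHS]big_ltn// mul0r add0r; apply: eq_big_nat => n /andP[n1 _].
by case: n n1 => // n _; rewrite /digit_series exprVn invfM mulrA.
Qed.

(** The terms are nonnegative and the first one is positive. As the derivative of
the characteristic series at 1 is not zero, 1 is a simple zero. *)
Lemma digit_series_deriv1 :
  ~ series (fun n => n%:R * digit_series beta one n * 1 ^+ n) @ \oo --> (0 : C).
Proof.
pose f n : R := if n is k.+1 then k.+1%:R * (digit beta k.+1 one)%:~R / beta ^+ k.+1 else 0.
have f0 n : 0 <= f n.
  case: n => [|n]; rewrite /f// digitS mulr_ge0 ?invr_ge0 ?exprn_ge0 ?(ltW beta_gt0)//.
  by rewrite mulr_ge0// (digit_ge0 beta_gt1).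
have fE : (fun n => n%:R * digit_series beta one n * 1 ^+ n) = (fun n => (f n)%:C).
  apply/funext => -[|n]; first by rewrite !mul0r.
  by rewrite expr1n mulr1 /f /digit_series !rmorphM fmorphV rmorphXn rmorph_nat rmorph_int mulrA.
have f1 : 0 < f 1%N.
  rewrite /f expr1 mul1r divr_gt0//.
  have := digit_tau beta one; have := tau_lt1 beta one.
  by rewrite [(to01 1)%:num]to01K ?ler01 ?lexx// mulr1; move: beta_gt1; lra.
rewrite fE => /cvgcP /(_ _ f1) [N _ /(_ (maxn N 2))/=].
rewrite leq_maxl => /(_ isT).
have -> : series (fun n => (f n)%:C) (maxn N 2) = (series f (maxn N 2))%:C.
  by rewrite !seriesEnat /= rmorph_sum.
rewrite sub0r normcN normc_real ger0_norm.
  rewrite ltNge => /negP; apply.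
  rewrite seriesEnat /= (big_cat_nat (leq0n 2) (leq_maxr N 2))/=.
  rewrite big_nat_recr//= big_nat1 addrAC lerDr addr_ge0 ?sumr_ge0//.
by rewrite seriesEnat /= sumr_ge0.
Qed.

Lemma ev_char_series rho a : normc a <= rho -> 0 <= rho < beta ->
  ev (char_series beta) a = 1 - ev (digit_series beta one) a.
Proof.
move=> ar /[dup] rb /andP[r0 _]; apply: ev_unique.
have h1 := ev_cvg ar (unit_summable r0).
have h2 := ev_cvg ar (digit_series_summable beta_gt1 one rb).
have := cvgcD h1 (cvgcZ (a := -1) h2); rewrite ev_unit mulN1r.
set f := fun n => _ + _.
suff -> : series (fun n => char_series beta n * a ^+ n) = f by [].
apply/funext; rewrite /f; elim=> [|n IH]; first by rewrite !series0 mulr0 addr0.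
by rewrite [LHS]seriesS_sum IH !seriesS_sum /char_series; ring.
Qed.

Lemma char_series_summable rho : 0 <= rho < beta -> summable_at rho (char_series beta).
Proof.
move=> /[dup] rb /andP[r0 _].
rewrite (_ : char_series beta = fun n => unit_series R[i] n + -1 * digit_series beta one n).
  apply: summable_atD => //; first exact: unit_summable.
  by apply: summable_atZ => //; exact: digit_series_summable.
by apply/funext => n; rewrite mulN1r.
Qed.

Lemma char_series_double_zero rho chi a : a != 0 -> normc a < rho -> rho < beta ->
  summable_at rho chi -> char_series beta = lin a^-1 chi -> ev chi a = 0 ->
  ev (digit_series beta one) a = 1 /\
  series (fun n => n%:R * digit_series beta one n * a ^+ n) @ \oo --> (0 : C).
Proof.
move=> a0 ar rb schi psiE chia.
have r0 : 0 <= rho by rewrite ltW// (le_lt_trans _ ar) ?normc_ge0.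
split.
  apply/eqP; rewrite eq_sym -subr_eq0 -(ev_char_series (ltW ar)) ?r0// psiE.
  by rewrite (ev_lin _ (ltW ar) schi) chia mulr0.
have := cvgcZ (a := -1) (double_zero_deriv a0 ar schi chia); rewrite -psiE mulr0.
set f := fun n => _.
suff -> : series (fun n => n%:R * digit_series beta one n * a ^+ n) = f by [].
apply/funext; rewrite /f; elim=> [|n IH]; first by rewrite !series0 mulr0.
rewrite !seriesS_sum IH /char_series mulrDr; congr (_ + _).
case: n {IH} => [|n]; first by rewrite !mul0r mulr0.
by rewrite /unit_series sub0r mulN1r mulrN mulNr opprK.
Qed.

(** The terms of [iter_PFhat] have norm at most 2 b^-n |c_i| and
2 |w_k| b^-(n-k) <= 2 B rho'^-n (rho' / b)^(n-k), a geometric sum since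
rho' < b. *)
Lemma decay_of_coef_bound (m : nat) (c : 'I_m -> R[i]) (x : 'I_m -> I) w rho' B :
  0 < rho' < beta -> cprod w (char_series beta) = (fun k => \sum_i c i * digit_series beta (x i) k) ->
  (forall n, normc (w n) * rho' ^+ n <= B) ->
  exists2 D, 0 < D & forall n,
    BVhat_norm (iter n L (BVclass (step_BV c x))) <= D * rho'^-1 ^+ n.
Proof.
move=> /andP[r0 rb] wpsi wB.
have B0 : 0 <= B by apply: le_trans (wB 0%N); rewrite expr0 mulr1 normc_ge0.
pose q := rho' / beta.
have q01 : 0 <= q < 1 by rewrite divr_ge0 ?(ltW r0) ?(ltW beta_gt0)//= ltr_pdivrMr// mul1r.
pose S := \sum_i normc (c i).
have S0 : 0 <= S by apply: sumr_ge0 => i _; exact: normc_ge0.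
pose G := B * (1 - q) ^- 2.
have G0 : 0 <= G.
  by rewrite mulr_ge0// invr_ge0 exprn_ge0// subr_ge0; case/andP: q01 => _ /ltW.
exists (S + G + (S + G) + 1); first by lra.
move=> n; rewrite step_cls (iter_PFhat beta_gt1 n wpsi).
pose b := \sum_i normc (c i) * beta ^- n +
  \sum_(k < n.+1) normc (w k) * beta ^- (n - k).
have bnd : cls_bound (\sum_i c i *: orbit_term beta (x i) n +
    \sum_(k < n.+1) w k *: orbit_term beta one (n - k)) b.
  by apply: cls_boundD; apply: cls_bound_sum => i; apply: cls_boundZ;
    exact: orbit_term_bound.
apply: le_trans (BVhat_norm_le bnd) _.
have rn0 : 0 <= rho'^-1 ^+ n by rewrite exprn_ge0// invr_ge0 ltW.
suff bS : b <= (S + G) * rho'^-1 ^+ n.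
  apply: le_trans (lerD bS bS) _; rewrite -mulrDl ler_wpM2r//; lra.
rewrite mulrDl; apply: lerD.
  rewrite mulr_suml; apply: ler_sum => i _; rewrite ler_wpM2l ?normc_ge0//.
  by rewrite -exprVn lerXn2r ?nnegrE ?invr_ge0 ?(ltW r0) ?(ltW beta_gt0)//
    lef_pV2 ?posrE// ltW.
have termE (k : 'I_n.+1) : normc (w k) * beta ^- (n - k) <=
    B * rho'^-1 ^+ n * q ^+ (n - k).
  have kn : (k <= n)%N by rewrite -ltnS.
  have -> : B * rho'^-1 ^+ n * q ^+ (n - k) = B * rho'^-1 ^+ k * beta ^- (n - k).
    rewrite -[X in rho'^-1 ^+ X](subnK kn) exprD /q expr_div_n.
    rewrite -!mulrA; congr (_ * _); rewrite mulrCA; congr (_ * _).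
    by rewrite mulrA -exprMn mulVf ?expr1n ?mul1r ?gt_eqF.
  rewrite ler_wpM2r ?invr_ge0 ?exprn_ge0 ?(ltW beta_gt0)//.
  by rewrite exprVn ler_pdivlMr ?exprn_gt0.
apply: le_trans (ler_sum _ (fun k _ => termE k)) _.
rewrite -mulr_sumr /G [leRHS]mulrAC; apply: ler_wpM2l; first by rewrite mulr_ge0.
apply: le_trans (arith_geo_bound q01 n.+1).
rewrite (reindex_inj rev_ord_inj) seriesEnat /= big_mkord.
apply: ler_sum => k _; rewrite subSS subKn -1?ltnS//.
case/andP: q01 => q0 _.
by rewrite ler_peMl ?exprn_ge0// ler1n.
Qed.

End Decay.

Theorem theorem4p6 (R : realType) (beta : R) (beta_gt1 : 1 < beta)
    (has_nonleading : exists lam : R[i], nonleading beta_gt1 lam)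
    (N : nat) (lambda : 'I_N -> R[i])
    (lambda_inj : injective lambda)
    (lambdaP : forall mu : R[i],
      subleading beta_gt1 mu <-> exists i, mu = lambda i)
    (lambda_simple : forall i, simple_eigenvalue beta_gt1 (lambda i))
    (K : nat) (K_ge1 : (1 <= K)%N)
    (c : 'I_(N + K).+1 -> R[i]) (x : 'I_(N + K).+1 -> {i01 R})
    (x_inj : injective x)
    (c_sol : decay_matrix beta lambda x *m (\col_i c i) = 0) :
  good_decay beta_gt1 (BVclass (step_BV c x)).
Proof.
have [lam0 nl0] := has_nonleading.
set M := subleading_modulus beta_gt1.
have beta_gt0 : 0 < beta by exact: (lt_trans ltr01 beta_gt1).
have M_gt : beta^-1 < M.
  by apply: lt_le_trans (subleading_modulus_ge nl0); case: nl0.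
have M_gt0 : 0 < M by apply: lt_trans M_gt; rewrite invr_gt0.
pose r := M^-1.
have r0 : 0 < r by rewrite invr_gt0.
have rb : r < beta by rewrite -[beta]invrK ltf_pV2 ?posrE ?invr_gt0.
(* All the zeros to be divided out have modulus 1 or r. *)
pose rho := (Num.max 1 r + beta) / 2.
have mb : Num.max 1 r < beta by rewrite gt_max beta_gt1.
have mrho : Num.max 1 r < rho by rewrite /rho; lra.
have rhob : rho < beta by rewrite /rho; lra.
have [rho1 rrho] : 1 < rho /\ r < rho by move: mrho; rewrite gt_max => /andP.
have rho0 : 0 <= rho by lra.
have lambda_sub i : subleading beta_gt1 (lambda i) by apply/lambdaP; exists i.
have lambda_norm i : normc (lambda i) = M by case: (lambda_sub i).
have lambda0 i : lambda i != 0 by rewrite -normc_gt0 lambda_norm.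
pose g k : R[i]^o := \sum_i c i * digit_series beta (x i) k.
have sphi y : summable_at rho (digit_series beta y) by apply: digit_series_summable; rewrite ?rho0.
have g_ev a : normc a <= rho -> ev g a = \sum_i c i * ev (digit_series beta (x i)) a.
  by move=> ar; exact: ev_sum ar (fun i => sphi (x i)).
have g1 : ev g 1 = 0.
  rewrite g_ev ?normc1 ?ltW//.
  have /matrixP/(_ (lshift N ord0) ord0) := c_sol.
  rewrite [LHS]mxE [RHS]mxE; apply: etrans; apply: eq_bigr => j _.
  by rewrite /decay_matrix col_mxEu !mxE ev_digit_series1// mulrC.
have g_lambda i : ev g (lambda i)^-1 = 0.
  rewrite g_ev; last by rewrite normcV lambda_norm ltW.
  have /matrixP/(_ (rshift 1 i) ord0) := c_sol.
  rewrite [LHS]mxE [RHS]mxE; apply: etrans; apply: eq_bigr => j _.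
  by rewrite /decay_matrix col_mxEd !mxE F_seriesE mulrC.
pose s := 1 :: [seq (lambda i)^-1 | i <- enum 'I_N].
have us : uniq s.
  rewrite /= map_inj_uniq ?enum_uniq ?andbT; last first.
    by move=> i j /invr_inj/lambda_inj.
  apply/mapP => -[i _ /(congr1 GRing.inv)]; rewrite invr1 invrK => l1.
  by have [[_ + _] _] := lambda_sub i; rewrite -l1 eqxx.
have sg : summable_at rho g by exact: summable_sum.
have [|||||w [rho' [B [/andP[rr' r'rho] wpsi wB]]]] :=
  @quotient_simple_zeros R r rho (char_series beta) g s _ _ sg _ us.
- by rewrite r0.
- by apply: char_series_summable; rewrite ?rho0.
- by rewrite /char_series /= subr0.
- move=> a; rewrite inE => /orP[/eqP ->|/mapP[i _ ->]].
    split; [exact: oner_neq0|by rewrite normc1|exact: g1|].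
    move=> chi schi psiE; apply/eqP => chi1.
    have ar1 : normc (1 : R[i]) < rho by rewrite normc1.
    by have [_ /(digit_series_deriv1 beta_gt1)] :=
      char_series_double_zero beta_gt1 (oner_neq0 _) ar1 rhob schi psiE chi1.
  have an : normc (lambda i)^-1 = r by rewrite normcV lambda_norm.
  have a0 : (lambda i)^-1 != 0 by rewrite invr_eq0.
  split=> //; first by rewrite an.
  move=> chi schi psiE; apply/eqP => chi1.
  have ar : normc (lambda i)^-1 < rho by rewrite an.
  have [phi1 dphi] := char_series_double_zero beta_gt1 a0 ar rhob schi psiE chi1.
  have := double_root_not_simple (beta_gt1 := beta_gt1) a0 _ phi1 dphi.
  by rewrite an rb invrK => /(_ isT); apply; exact: lambda_simple.
- move=> z zr psiz.
  have phi1 : ev (digit_series beta (to01 1)) z = 1.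
    apply/eqP; rewrite eq_sym -subr_eq0 -(ev_char_series beta_gt1 (rho := rho)) ?psiz ?rho0//.
    by rewrite (le_trans zr) ?ltW.
  have z0 : z != 0.
    apply: contraPneq phi1 => ->; rewrite ev0 /=.
    by apply/eqP; rewrite eq_sym oner_eq0.
  have [->|z1] := eqVneq z 1; first exact: mem_head.
  have eig := root_eigenvalue beta_gt1 z0 (le_lt_trans zr rb) phi1.
  have zM : M <= normc z^-1.
    by rewrite normcV -[M]invrK lef_pV2 ?posrE ?normc_gt0.
  have nlz : nonleading beta_gt1 z^-1.
    split=> //; last exact: lt_le_trans zM.
    by apply: contraNneq z1 => /(congr1 GRing.inv); rewrite invrK invr1 => /eqP.
  have /lambdaP[i zi] : subleading beta_gt1 z^-1.
    split=> //; apply/eqP; rewrite eq_le zM andbT.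
    exact: subleading_modulus_ge.
  by rewrite inE; apply/orP; right; apply/mapP; exists i; rewrite ?mem_enum// -zi invrK.
have r'0 : 0 < rho' by exact: lt_trans rr'.
have r'b : rho' < beta by exact: le_lt_trans r'rho rhob.
have [|D D0 decay] := decay_of_coef_bound beta_gt1 _ wpsi wB; first by rewrite r'0.
exists D, rho'^-1; split=> //.
by rewrite lef_pV2 ?posrE// (ltW r'b)/= -/M -[M]invrK ltf_pV2 ?posrE.
Qed.
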